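(* Let $\{P_\theta:\theta\in\Theta\}$ be a parametric family of probability distributions on $\mathbb{R}^p$ with finite first moments, let $\theta^*\in\Theta$, and let $P$ be a distribution on $\mathbb{R}^p$ with $W(P,P_{\theta^*})\le\epsilon$. Let $X_1,\dots,X_n\stackrel{i.i.d.}{\sim}P$, let $B>0$ and $L\ge 2$, and let $\widehat\theta$ be the W-GAN estimator with function class $\mathcal{D}(B,L)$. There is a universal constant $C>0$ such that for any $\delta>0$, with probability at least $1-\delta$, $$\sup_{f\in\mathcal{D}(B,L)}\left|\mathbb{E}_{P_{\theta^*}}f(X)-\mathbb{E}_{P_{\widehat\theta}}f(X)\right|\le 2C\left(2^{L}\sqrt{\frac{p}{n}}+\sqrt{\frac{2\log(1/\delta)}{n}}\right)+\frac{B}{2}\epsilon.$$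
   Context: $W(P,Q)=\inf_{\Pi}\mathbb{E}_{(X,Y)\sim\Pi}\|X-Y\|_2$ is the Wasserstein-1 distance, the infimum being over couplings $\Pi$ of $P$ and $Q$. The function class $\mathcal{D}(B,L)$ of neural networks $f:\mathbb{R}^p\to\mathbb{R}$ is defined as follows. Nodes of the first layer are functions $x\mapsto\sigma(w^Tx+b)$ with $\sigma(u)=1/(1+e^{-u})$, $w\in\mathbb{R}^p$, $\|w\|_2\le B$, $b\in\mathbb{R}$. For $1\le l<L-1$, a node of layer $l+1$ is a function $x\mapsto \mathrm{ReLU}\big(\sum_{i=1}^{d^{(l)}}w_if^{(l)}_i(x)\big)$ where $\mathrm{ReLU}(u)=\max(u,0)$, $f^{(l)}_i$ are nodes of layer $l$, $d^{(l)}$ is a finite width, and $\sum_i|w_i|\le1$. The output is $f(x)=\sum_{i=1}^{d^{(L-1)}}w_if^{(L-1)}_i(x)$ with $\sum_i|w_i|\le 1$ and $f^{(L-1)}_i$ nodes of layer $L-1$ (no output activation). Given a family $\{P_\theta:\theta\in\Theta\}$, a function class $\mathcal{D}$ and data $X_1,\dots,X_n$ with empirical distribution $P_n$, the W-GAN estimator is $\widehat\theta\in\arg\min_{\theta\in\Theta}\sup_{f\in\mathcal{D}}\{\mathbb{E}_{P_n}f(X)-\mathbb{E}_{P_\theta}f(X)\}$ (assumed to be attained). *)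

(* Defs.v *)
From HB Require Import structures.
From mathcomp Require Import all_boot all_order all_algebra.
From mathcomp Require Import all_classical all_reals all_analysis.
From mathcomp Require Import Rstruct Rstruct_topology.
Set Implicit Arguments. Unset Strict Implicit. Unset Printing Implicit Defensive.
Import Order.TTheory GRing.Theory Num.Theory.
Import numFieldNormedType.Exports.
Local Open Scope classical_set_scope.
Local Open Scope ring_scope.

(* R^p with its Borel sigma-algebra (generated by the open sets of the
   product (= Euclidean) topology of 'rV[R]_p). *)
Definition Rp (R : realType) (p : nat) :=
  g_sigma_algebraType (@open ('rV[R]_p)).

Definition dotp (R : realType) (p : nat) (w x : 'rV[R]_p) : R :=
  \sum_(i < p) w ord0 i * x ord0 i.
Definition norm2 (R : realType) (p : nat) (x : 'rV[R]_p) : R :=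
  Num.sqrt (\sum_(i < p) x ord0 i ^+ 2).

Definition sigmoid (R : realType) (u : R) : R := 1 / (1 + expR (- u)).
Definition ReLU (R : realType) (u : R) : R := Num.max u 0.

Fixpoint layer_nodes (R : realType) (p : nat) (B : R) (l : nat)
  : set ('rV[R]_p -> R) :=
  match l with
  | 0 => set0
  | 1 => [set f | exists (w : 'rV[R]_p) (b : R),
            norm2 w <= B /\ f = (fun x => sigmoid (dotp w x + b))]
  | l'.+1 =>
      [set f | exists (d : nat) (w : 'I_d -> R) (g : 'I_d -> 'rV[R]_p -> R),
          (0 < d)%N /\ (forall i, @layer_nodes R p B l' (g i)) /\
          \sum_(i < d) `|w i| <= 1 /\
          f = (fun x => ReLU (\sum_(i < d) w i * g i x))]
  end.

Definition Dnet (R : realType) (p : nat) (B : R) (L : nat)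
  : set ('rV[R]_p -> R) :=
  [set f | exists (d : nat) (w : 'I_d -> R) (g : 'I_d -> 'rV[R]_p -> R),
      (0 < d)%N /\ (forall i, @layer_nodes R p B L.-1 (g i)) /\
      \sum_(i < d) `|w i| <= 1 /\
      f = (fun x => \sum_(i < d) w i * g i x)].

Definition expect (R : realType) (p : nat) (Q : probability (Rp R p) R)
  (f : 'rV[R]_p -> R) : \bar R :=
  (\int[Q]_x (f x)%:E)%E.

Definition finite_first_moment (R : realType) (p : nat)
  (Q : probability (Rp R p) R) : Prop :=
  Q.-integrable setT (fun x : Rp R p => (norm2 x)%:E).

Definition coupling (R : realType) (p : nat) (P Q : probability (Rp R p) R)
  (Pi : probability (Rp R p * Rp R p)%type R) : Prop :=
  (forall A : set (Rp R p), measurable A -> Pi (fst @^-1` A) = P A) /\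
  (forall A : set (Rp R p), measurable A -> Pi (snd @^-1` A) = Q A).

Definition W1 (R : realType) (p : nat) (P Q : probability (Rp R p) R) : \bar R :=
  ereal_inf [set (\int[Pi]_z (norm2 (z.1 - z.2 : 'rV[R]_p))%:E)%E
            | Pi in [set Pi | coupling P Q Pi]].

Definition iid_sample (R : realType) (d : measure_display) (Omega : measurableType d)
  (Pr : probability Omega R) (p n : nat) (X : 'I_n -> Omega -> Rp R p)
  (P : probability (Rp R p) R) : Prop :=
  (forall i, measurable_fun setT (X i)) /\
  (forall i (A : set (Rp R p)), measurable A -> Pr (X i @^-1` A) = P A) /\
  (forall A : 'I_n -> set (Rp R p), (forall i, measurable (A i)) ->
      Pr (\bigcap_i (X i @^-1` A i)) = (\prod_(i < n) Pr (X i @^-1` A i))%E).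

Definition emp_mean (R : realType) (p n : nat) (xs : 'I_n -> 'rV[R]_p)
  (f : 'rV[R]_p -> R) : R :=
  n%:R^-1 * \sum_(i < n) f (xs i).

Definition wgan_obj (R : realType) (p n : nat) (Theta : Type)
  (Pth : Theta -> probability (Rp R p) R) (D : set ('rV[R]_p -> R))
  (xs : 'I_n -> 'rV[R]_p) (th : Theta) : \bar R :=
  ereal_sup [set ((emp_mean xs f)%:E - expect (Pth th) f)%E | f in D].

Definition is_wgan_estimate (R : realType) (p n : nat) (Theta : Type)
  (Pth : Theta -> probability (Rp R p) R) (D : set ('rV[R]_p -> R))
  (xs : 'I_n -> 'rV[R]_p) (th : Theta) : Prop :=
  forall th' : Theta, (wgan_obj Pth D xs th <= wgan_obj Pth D xs th')%E.

(* Main.v *)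
Require Import Defs.
From HB Require Import structures.
From mathcomp Require Import all_boot all_order all_algebra.
From mathcomp Require Import all_classical all_reals all_analysis.
From mathcomp Require Import measurable_realfun.
From mathcomp Require Import ring lra zify.
Set Implicit Arguments. Unset Strict Implicit. Unset Printing Implicit Defensive.
Import Order.TTheory GRing.Theory Num.Theory.
Import numFieldNormedType.Exports.
Local Open Scope ring_scope.

(** Networks in [Dnet B L] are [B/4]-Lipschitz, so the Wasserstein contamination costs at most [B/4 * eps] per expectation, and by optimality of the estimator the theorem reduces to a deviation bound for [sup_f |P_n f - P f|].

Quantizing finitely many networks replaces [P] by a law on a finite set, where independence on rectangles is all one needs. Symmetrization with exponential moments, and bounded differences for the random signs, then reduce the bound to the Rademacher complexity of the class at fixed points. Each ReLU layer at most doubles it (contraction and convex hulls). On the sigmoid layer, monotonicity turns it into the complexity of halfspaces, which is [O(sqrt (p n))] without logarithmic loss by chaining: Pajor's lemma, Radon's argument and random sampling bound the size of [n / 4^j]-separated families of halfspace traces by [exp (O(p (j + 1)))].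

Finally the class has a countable pointwise dense subset, because its members are uniformly Lipschitz, so a bound over finite subclasses extends to the whole class. *)

(** The obstacle is the rate: a single union bound over all halfspace traces on n points would cost
    a factor sqrt (log n). The count used at scale n / 4^j does not involve n: a random subsample of
    size proportional to 4^j log |G| already tells the members of G apart, and log |G| then
    satisfies an inequality that can be solved for it. Concentration goes through the Laplace
    transform of the symmetrized process, so bounded differences are needed only for signs, where
    every expectation is a finite average. The constant 160 is 40 from the chaining series, doubled
    by symmetrization and doubled again when sqrt (p + 1) is replaced by sqrt p. *)

(** * Rademacher averages *)

(* [rade n u F v] is the expectation of [F (v + \sum_(i < n) e_i u_i)] over independent uniform signs [e_i]. *)
Fixpoint rade (R : realType) (V : zmodType) (n : nat) (u : nat -> V)
    (F : V -> R) (v : V) : R :=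
  if n is m.+1 then (rade m u F (v + u m) + rade m u F (v - u m)) / 2 else F v.

Section Rade.
Variables (R : realType) (V : zmodType).
Implicit Types (u : nat -> V) (F G : V -> R) (v w : V).

Lemma rade_shift n u F v w :
  rade n u F (v + w) = rade n u (fun x => F (x + w)) v.
Proof.
elim: n v => [//|n IH] v /=.
by rewrite -!IH addrAC [v + w - _]addrAC.
Qed.

(** An extra sign can be averaged outside or inside the others, so the outermost sign can be treated
    pointwise. *)
Lemma rade_avg n u F v w :
  (rade n u F (v + w) + rade n u F (v - w)) / 2
    = rade n u (fun x => (F (x + w) + F (x - w)) / 2) v.
Proof.
rewrite !rade_shift; elim: n v => [//|n IH] v /=.
by rewrite -!IH; lra.
Qed.

Lemma rade_le_in (P : V -> Prop) n u F G v : P v ->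
  (forall i x, P x -> P (x + u i) /\ P (x - u i)) ->
  (forall x, P x -> F x <= G x) -> rade n u F v <= rade n u G v.
Proof.
move=> Pv Pu FG; elim: n v Pv => [|n IH] v Pv /=; first exact: FG.
have [P1 P2] := Pu n v Pv.
by rewrite ler_pM2r ?invr_gt0//; apply: lerD; apply: IH.
Qed.

Lemma rade_le n u F G v :
  (forall x, F x <= G x) -> rade n u F v <= rade n u G v.
Proof. by move=> FG; apply: (@rade_le_in (fun=> True)). Qed.

Lemma rade_eq n u F G v : F =1 G -> rade n u F v = rade n u G v.
Proof. by move=> /funext ->. Qed.

Lemma eq_rade n u u' F v : (forall i, (i < n)%N -> u i = u' i) ->
  rade n u F v = rade n u' F v.
Proof.
elim: n v => [//|n IH] v uu' /=.
by rewrite !IH ?uu' // => i /ltnW/uu'.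
Qed.

Lemma rade_const n u (a : R) v : rade n u (fun=> a) v = a.
Proof. by elim: n v => [//|n IH] v /=; rewrite !IH; lra. Qed.

Lemma radeD n u F G v :
  rade n u (fun x => F x + G x) v = rade n u F v + rade n u G v.
Proof. by elim: n v => [//|n IH] v /=; rewrite !IH; lra. Qed.

Lemma radeZ n u (a : R) F v :
  rade n u (fun x => a * F x) v = a * rade n u F v.
Proof. by elim: n v => [//|n IH] v /=; rewrite !IH; lra. Qed.

Lemma rade_sum (I : Type) (r : seq I) (Q : pred I) n u (F : I -> V -> R) v :
  rade n u (fun x => \sum_(i <- r | Q i) F i x) v
    = \sum_(i <- r | Q i) rade n u (F i) v.
Proof.
elim: r => [|i r IH].
  by under rade_eq do rewrite big_nil; rewrite rade_const big_nil.
rewrite big_cons -IH; under rade_eq do rewrite big_cons.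
by case: (Q i) => //; rewrite radeD.
Qed.

Lemma rade_opp n u F v : rade n u (fun x => F (- x)) v = rade n u F (- v).
Proof.
elim: n v => [//|n IH] v /=.
by rewrite !IH !opprD opprK addrC.
Qed.

Lemma rade_dist n u F v w (b : R) : (forall x, `|F (x + w) - F (x - w)| <= b) ->
  `|rade n u F (v + w) - rade n u F (v - w)| <= b.
Proof.
move=> Fb; rewrite ler_distl !rade_shift.
apply/andP; split.
- rewrite lerBlDr -(rade_const n u b v) -radeD; apply: rade_le => x.
  by have := Fb x; rewrite ler_distl => /andP[]; lra.
- rewrite -(rade_const n u b v) -radeD; apply: rade_le => x.
  by have := Fb x; rewrite ler_distl => /andP[]; lra.
Qed.

(* For [x^2 <= 1/2]: [cosh x <= (1/(1-x) + 1/(1+x))/2 = 1/(1-x^2) <= 1+2x^2]. *)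
Lemma cosh_le (x : R) : (expR x + expR (- x)) / 2 <= expR (2 * x ^+ 2).
Proof.
have [xs|xb] := lerP (x ^+ 2) (1 / 2).
- have h1 : x < 1 by nra.
  have h2 : -1 < x by nra.
  apply: (@le_trans _ _ (1 + 2 * x ^+ 2)); last exact: expR_ge1Dx.
  have a1 : expR x <= (1 - x)^-1.
    rewrite -[x]opprK expRN opprK lef_pV2 ?posrE ?expR_gt0 ?subr_gt0//.
    exact: expR_ge1Dx.
  have a2 : expR (- x) <= (1 + x)^-1.
    rewrite expRN lef_pV2 ?posrE ?expR_gt0//; last by lra.
    exact: expR_ge1Dx.
  have e : (1 - x)^-1 + (1 + x)^-1 = 2 * (1 - x ^+ 2)^-1.
    have n1 : 1 - x != 0 by rewrite lt0r_neq0// subr_gt0.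
    have n2 : 1 + x != 0 by rewrite lt0r_neq0//; lra.
    have -> : 1 - x ^+ 2 = (1 - x) * (1 + x) by ring.
    rewrite invfM.
    by field; rewrite n1 n2.
  have : (1 - x ^+ 2)^-1 <= 1 + 2 * x ^+ 2.
    rewrite -[leRHS]invrK lef_pV2 ?posrE ?invr_gt0; [|nra|nra].
    rewrite -[leLHS]mul1r ler_pdivrMr; nra.
  by nra.
- have h : `|x| <= 2 * x ^+ 2.
    have x0 := normr_ge0 x; have xx := real_normK (num_real x).
    have [|h] := lerP (1 / 2) `|x|; nra.
  have e1 : expR x <= expR (2 * x ^+ 2).
    by rewrite ler_expR (le_trans _ h)// ler_norm.
  have e2 : expR (- x) <= expR (2 * x ^+ 2).
    by rewrite ler_expR (le_trans _ h)// -normrN ler_norm.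
  by lra.
Qed.

(** The midpoint factors out of both exponentials and leaves the [cosh] of half the difference. *)
Lemma cosh_shift_le (a b t : R) : `|a - b| <= 2 * t ->
  (expR a + expR b) / 2 <= expR ((a + b) / 2 + 2 * t ^+ 2).
Proof.
move=> ab.
have -> : expR a + expR b
    = expR ((a + b) / 2) * (expR ((a - b) / 2) + expR (- ((a - b) / 2))).
  by rewrite mulrDr -!expRD; congr (expR _ + expR _); lra.
rewrite expRD -mulrA ler_wpM2l ?expR_ge0//.
apply: le_trans (cosh_le _) _; rewrite ler_expR.
have := normr_ge0 (a - b); have := real_normK (num_real (a - b)).
by rewrite expr_div_n; nra.
Qed.

(** McDiarmid's argument for signs. Averaging over the remaining signs does not increase the
    oscillation in sign [n], so [rade_dist] bounds the gap between the two conditional means and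
    each sign costs a factor [expR (2 * b ^+ 2)]. *)
Lemma rade_expR_bounded_diff n u F v (b : R) :
  (forall i x, `|F (x + u i) - F (x - u i)| <= 2 * b) ->
  rade n u (fun x => expR (F x)) v <= expR (rade n u F v + 2 * n%:R * b ^+ 2).
Proof.
move=> Fb; elim: n v => [|n IH] v /=; first by rewrite mulr0 mul0r addr0.
set m1 := rade n u F (v + u n); set m2 := rade n u F (v - u n).
have h : `|m1 - m2| <= 2 * b by apply: rade_dist.
have := cosh_shift_le h; have := IH (v + u n); have := IH (v - u n).
rewrite -/m1 -/m2 !(expRD _ (2 * n%:R * _)).
have -> : expR ((m1 + m2) / 2 + 2 * n.+1%:R * b ^+ 2) =
   expR ((m1 + m2) / 2 + 2 * b ^+ 2) * expR (2 * n%:R * b ^+ 2).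
  by rewrite -expRD -natr1; congr expR; ring.
by have := expR_gt0 (2 * n%:R * b ^+ 2); nra.
Qed.

(** For additive [l] the oscillation is known sign by sign; chaining needs this sum of squares
    rather than [n] times a worst case. *)
Lemma rade_expR_linear n u (l : {additive V -> R}) v :
  rade n u (fun x => expR (l x)) v
    <= expR (l v + 2 * \sum_(i < n) l (u i) ^+ 2).
Proof.
elim: n v => [|n IH] v /=; first by rewrite big_ord0 mulr0 addr0.
have := IH (v + u n); have := IH (v - u n).
rewrite raddfB raddfD big_ord_recr /=.
set s := \sum_(_ < _) _.
have /cosh_shift_le : `|(l v + l (u n)) - (l v - l (u n))| <= 2 * `|l (u n)|.
  by rewrite [X in `|X|](_ : _ = 2 * l (u n)) ?normrM ?normr_nat//; ring.
rewrite real_normK ?num_real// !(expRD _ (2 * s)).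
have -> : expR (l v + 2 * (s + l (u n) ^+ 2)) =
  expR ((l v + l (u n) + (l v - l (u n))) / 2 + 2 * l (u n) ^+ 2) * expR (2 * s).
  by rewrite -expRD; congr expR; lra.
by have := expR_gt0 (2 * s); nra.
Qed.

End Rade.

(** Serves to pass between sign vectors and processes indexed by a function class. *)
Lemma rade_comp (R : realType) (V W : zmodType) (L : V -> W)
    n (u : nat -> V) (F : W -> R) v : zmod_morphism L ->
  rade n u (fun x => F (L x)) v = rade n (fun i => L (u i)) F (L v).
Proof.
move=> LB; have L0 : L 0 = 0 by rewrite -(subrr 0) LB subrr.
have LD x y : L (x + y) = L x + L y.
  by rewrite -{1}[y]opprK LB -[- y]sub0r LB L0 sub0r opprK.
by elim: n v => [//|n IH] v /=; rewrite !IH LD LB.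
Qed.

(** * Contraction principle for Lipschitz maps *)

Section Contraction.
Local Open Scope classical_set_scope.
Local Open Scope ring_scope.
Variables (R : realType) (I : Type) (T : set I).
Hypothesis T0 : T !=set0.

(** [sup] takes a default value on unbounded sets, so boundedness is an invariant to carry along the
    signs. *)
Definition bounded_on (c : I -> R) := exists M, forall t, T t -> `|c t| <= M.

Lemma bounded_onD c c' : bounded_on c -> bounded_on c' ->
  bounded_on (fun t => c t + c' t).
Proof.
move=> [M cM] [M' cM']; exists (M + M') => t Tt.
by rewrite (le_trans (ler_normD _ _))// lerD ?cM ?cM'.
Qed.

Lemma bounded_onN c : bounded_on c -> bounded_on (fun t => - c t).
Proof. by move=> [M cM]; exists M => t Tt; rewrite normrN cM. Qed.

Lemma bounded_sup_ub (c : I -> R) t : bounded_on c -> T t ->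
  c t <= sup [set c x | x in T].
Proof.
move=> [M cM] Tt; apply: ub_le_sup; last by exists t.
by exists M => _ [x Tx <-]; rewrite (le_trans (ler_norm _))// cM.
Qed.

Lemma sup_le_bound (c : I -> R) a : (forall t, T t -> c t <= a) ->
  sup [set c x | x in T] <= a.
Proof.
move=> ca; apply: ge_sup; first by case: T0 => t Tt; exists (c t), t.
by move=> _ [x Tx <-]; exact: ca.
Qed.

(** For points [s] and [t] in the two suprema, [phi (a s) - phi (a t)] is at most [|a s - a t|]; the
    sign of [a s - a t] decides which point is used with [+ a] and which with [- a]. *)
Lemma sup_contraction (phi : R -> R) (c a : I -> R) :
  (forall x y, `|phi x - phi y| <= `|x - y|) ->
  bounded_on c -> bounded_on a ->
  sup [set c t + phi (a t) | t in T] + sup [set c t - phi (a t) | t in T]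
  <= sup [set c t + a t | t in T] + sup [set c t - a t | t in T].
Proof.
move=> lip bc ba.
have bD : bounded_on (fun t => c t + a t) by apply: bounded_onD.
have bB : bounded_on (fun t => c t - a t) by apply: bounded_onD => //; apply: bounded_onN.
rewrite -lerBrDr; apply: sup_le_bound => s Ts.
rewrite lerBrDr addrC -lerBrDr; apply: sup_le_bound => t Tt.
have := lip (a s) (a t); have := ler_norm (phi (a s) - phi (a t)).
have := bounded_sup_ub bD Ts; have := bounded_sup_ub bD Tt.
have := bounded_sup_ub bB Ts; have := bounded_sup_ub bB Tt.
by case: (ler0P (a s - a t)) => h; lra.
Qed.

Lemma rade_contraction (phi : R -> R) n (a : nat -> I -> R) (c : I -> R) :
  (forall x y, `|phi x - phi y| <= `|x - y|) ->
  (forall i, bounded_on (a i)) -> bounded_on c ->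
  rade n (fun i t => phi (a i t)) (fun c => sup [set c t | t in T]) c
  <= rade n a (fun c => sup [set c t | t in T]) c.
Proof.
move=> lip ba; elim: n c => [//|n IH] c bc.
have bpa i : bounded_on (fun t => phi (a i t)).
  have [M aM] := ba i; exists (M + `|phi 0|) => t Tt.
  have := lip (a i t) 0; rewrite subr0 => h; have := aM t Tt.
  by have := ler_normD (phi (a i t) - phi 0) (phi 0); rewrite subrK; lra.
set S := fun c => sup [set c t | t in T].
(* [rade_avg] brings sign [n] inside, where it is contracted pointwise; it is then moved back out
   and the induction hypothesis treats the other signs. *)
rewrite /= !rade_avg; apply: (@le_trans _ _ (rade n (fun i t => phi (a i t))
  (fun x => (S (x + a n) + S (x - a n)) / 2) c)).
  apply: (@rade_le_in _ _ bounded_on) => // [i x bx|x bx].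
    by split; apply: bounded_onD => //; apply: bounded_onN.
  by rewrite ler_pM2r ?invr_gt0//; apply: sup_contraction.
by rewrite -!rade_avg ler_pM2r ?invr_gt0// lerD// IH//;
  apply: bounded_onD => //; apply: bounded_onN.
Qed.
End Contraction.

(** * Halfspaces: VC dimension and separated families *)

Section Pajor.
Import mathcomp.boot.fintype mathcomp.boot.finset.
Variable I : finType.
Implicit Types (F : {set {set I}}) (S : {set I}).

Definition shatters F S :=
  [forall A : {set I}, (A \subset S) ==> [exists B in F, B :&: S == A]].

Lemma shattersP F S : reflect
  (forall A : {set I}, A \subset S -> exists2 B, B \in F & B :&: S = A)
  (shatters F S).
Proof.
apply: (iffP forallP) => h A.
- by move=> AS; have /implyP/(_ AS)/exists_inP[B BF /eqP] := h A; exists B.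
- by apply/implyP => /h[B BF BS]; apply/exists_inP; exists B => //; apply/eqP.
Qed.

(** Split [F] by membership of a point [i]. A set shattered by both halves is counted twice; its
    extension by [i] is also shattered by [F] and supplies the second count. *)
Lemma pajor F : (#|F| <= #|[set S | shatters F S]|)%N.
Proof.
have [n] := ubnP #|F|; elim: n F => // n IH F Fn.
have [F1|/card_gt1P[B [B' [BF B'F BB']]]] := leqP #|F| 1.
  case: (set_0Vmem F) => [->|[B BF]]; first by rewrite cards0.
  apply: leq_trans F1 _; apply/card_gt0P; exists set0; rewrite inE.
  apply/shattersP => A; rewrite subset0 => /eqP ->.
  by exists B => //; rewrite setI0.
(* Taking [i] where two members differ makes both halves nonempty, hence both strictly smaller than
   [F]. *)
have [i iBB'] : exists i, (i \in B) != (i \in B').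
  apply/existsP; apply: contra_neqT BB' => /existsPn h; apply/setP => i.
  by apply/eqP; rewrite -[_ == _]negbK; exact: h.
pose F0 := [set C in F | i \notin C]; pose F1 := [set C in F | i \in C].
have cF : #|F| = (#|F0| + #|F1|)%N.
  rewrite -cardsUI; have -> : F0 :&: F1 = set0.
    by apply/setP => C; rewrite !inE; case: (i \in C); rewrite ?andbF.
  rewrite cards0 addn0; congr #|pred_of_set _|; apply/setP => C.
  by rewrite !inE; case: (C \in F); case: (i \in C).
have [F0p F1p] : (0 < #|F0|)%N /\ (0 < #|F1|)%N.
  move: iBB'; have [iB iB'|iB iB'] := boolP (i \in B).
  - by split; apply/card_gt0P; [exists B'|exists B]; rewrite inE ?BF ?B'F.
  - have {}iB' : i \in B' by case: (i \in B') iB'.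
    by split; apply/card_gt0P; [exists B|exists B']; rewrite inE ?BF ?B'F.
have IH0 : (#|F0| <= #|[set S | shatters F0 S]|)%N by apply: IH; lia.
have IH1 : (#|F1| <= #|[set S | shatters F1 S]|)%N by apply: IH; lia.
set H0 := [set S | _] in IH0; set H1 := [set S | _] in IH1.
have niH0 S : S \in H0 -> i \notin S.
  rewrite inE => /shattersP/(_ _ (subxx S))[C]; rewrite inE => /andP[_ iC] <-.
  by rewrite inE negb_and iC.
have niH1 S : S \in H1 -> i \notin S.
  rewrite inE => /shattersP/(_ _ (sub0set S))[C].
  rewrite inE => /andP[_ iC] CS; apply: contraT => /negbNE iS.
  by have := in_set0 i; rewrite -CS inE iC iS.
rewrite cF; apply: leq_trans (leq_add IH0 IH1) _.
have -> : (#|H0| + #|H1|)%N = (#|H0 :|: H1| + #|[set i |: S | S in H0 :&: H1]|)%N.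
  rewrite card_in_imset ?cardsUI// => S S' /setIP[/niH0 iS _] /setIP[/niH0 iS' _].
  by move=> e; rewrite -(setU1K iS) e setU1K.
rewrite -cardsUI.
have -> : (H0 :|: H1) :&: [set i |: S | S in H0 :&: H1] = set0.
  apply/setP => S; rewrite in_set0; apply/negP.
  move=> /setIP[/setUP SH /imsetP[S' _ SS']].
  have : i \notin S by case: SH => [/niH0|/niH1].
  by rewrite SS' setU11.
rewrite cards0 addn0; apply/subset_leq_card/subsetP => S.
move=> /setUP[/setUP[]|/imsetP[S' /setIP[]]].
- rewrite !inE => /shattersP h; apply/shattersP => A /h[C].
  by rewrite inE => /andP[CF _]; exists C.
- rewrite !inE => /shattersP h; apply/shattersP => A /h[C].
  by rewrite inE => /andP[CF _]; exists C.
- move=> h0 h1 ->; have iS' := niH0 _ h0; move: h0 h1.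
  rewrite !inE => /shattersP h0 /shattersP h1; apply/shattersP => A AS.
  have AS' : A :\ i \subset S' by rewrite subDset.
  have [iA|iA] := boolP (i \in A).
  + have [C] := h1 _ AS'; rewrite inE => /andP[CF iC] CS; exists C => //.
    rewrite setIUr CS; apply/setP => k; rewrite !inE.
    by have [->|] := eqVneq k i; rewrite ?iC ?iA ?andbT ?andbF.
  + have [C] := h0 _ AS'; rewrite inE => /andP[CF iC] CS; exists C => //.
    rewrite setIUr CS; apply/setP => k; rewrite !inE.
    by have [->|] := eqVneq k i; rewrite ?(negbTE iC) ?(negbTE iA) ?andbT ?andbF.
Qed.

End Pajor.

(** Weight each set [S] by [x ^+ #|S|]: the total weight is [(1 + x) ^+ m], and a set with at most
    [d] elements weighs at least [x ^+ d]. *)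
Lemma card_small_sets (R : realType) (m d : nat) (x : R) : 0 < x -> x <= 1 ->
  #|[set S : {set 'I_m} | (#|S| <= d)%N]|%:R * x ^+ d <= (1 + x) ^+ m.
Proof.
move=> x0 x1.
have -> : (1 + x) ^+ m = \sum_(S : {set 'I_m}) x ^+ #|S|.
  transitivity (\prod_(i < m) (x + 1)); first by rewrite prodr_const card_ord addrC.
  rewrite bigA_distr; apply: eq_big => [S|S _]; first by rewrite inE.
  by rewrite -big_mkcond prodr_const.
rewrite [leRHS](bigID [pred S : {set 'I_m} | (#|S| <= d)%N]) /= -[leLHS]addr0 lerD//.
  rewrite mulr_natl -sumr_const big_mkcond [leRHS]big_mkcond.
  apply: ler_sum => S _; rewrite inE; case: ifP => // Sd.
  by apply: ler_wiXn2l => //; exact: ltW.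
by apply: sumr_ge0 => S _; rewrite exprn_ge0// ltW.
Qed.

Definition symdiff (I : finType) (S S' : {set I}) := (S :\: S') :|: (S' :\: S).

(** Hamming distance above [n / 4 ^ j] means Euclidean distance of indicators above
    [sqrt n / 2 ^ j], a dyadic scale; the product form stays in [nat]. *)
Definition separated n j (G : {set {set 'I_n}}) :=
  forall S S', S \in G -> S' \in G -> S != S' -> (n < 4 ^ j * #|symdiff S S'|)%N.

Section Halfspaces.
Import mathcomp.boot.fintype mathcomp.boot.finset.
Variables (R : realType) (p : nat).

Definition halfspace_cut n (y : 'I_n -> 'rV[R]_p) (S : {set 'I_n}) : Prop :=
  exists (w : 'rV[R]_p) (b : R), forall i, (i \in S) = (0 < dotp w (y i) + b).

(* An affine dependence [c] among the points: a halfspace cutting out exactly the points with [c > 0] would make [\sum c k * (w . y k + b) = 0] positive. *)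
Lemma halfspace_vc n (y : 'I_n -> 'rV[R]_p) (G : {set {set 'I_n}}) S :
  (forall A, A \in G -> halfspace_cut y A) -> shatters G S -> (#|S| <= p.+1)%N.
Proof.
move=> Gy /shattersP GS; rewrite leqNgt; apply/negP => pS.
pose Y : 'M[R]_(#|S|, p) := \matrix_(k, j) y (enum_val k) ord0 j.
(* The column of ones makes a left kernel vector sum to zero, so the offset [b] drops out below. *)
pose A := row_mx Y (const_mx 1 : 'cV[R]_#|S|).
have kA : kermx A != 0.
  rewrite -mxrank_eq0 mxrank_ker -lt0n subn_gt0.
  by apply: leq_ltn_trans (rank_leq_col A) _; rewrite addn1.
have [c cA c0] := rowV0Pn kA.
have {}cA : c *m A = 0 by apply/sub_kermxP.
move: cA; rewrite mul_mx_row => /eqP; rewrite row_mx_eq0 => /andP[/eqP cY /eqP c1].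
have {}c1 : \sum_k c ord0 k = 0.
  have /matrixP/(_ ord0 ord0) := c1; rewrite !mxE => e; rewrite -[RHS]e.
  by apply: eq_bigr => k _; rewrite mxE mulr1.
have {}cY j : \sum_k c ord0 k * y (enum_val k) ord0 j = 0.
  have /matrixP/(_ ord0 j) := cY; rewrite !mxE => e; rewrite -[RHS]e.
  by apply: eq_bigr => k _; rewrite mxE.
pose P := [set enum_val k | k in [set k | 0 < c ord0 k]].
have PS : P \subset S by apply/subsetP => _ /imsetP[k _ ->]; exact: enum_valP.
have [B /Gy[w [b wb]] BP] := GS _ PS.
pose g (k : 'I_#|S|) := dotp w (y (enum_val k)) + b.
have cg k : (0 < c ord0 k) = (0 < g k).
  rewrite /g -wb; have : (enum_val k \in P) = (enum_val k \in B).
    by rewrite -BP inE enum_valP andbT.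
  by move=> <-; rewrite mem_imset ?inE//; exact: enum_val_inj.
have s0 : \sum_k c ord0 k * g k = 0.
  under eq_bigr do rewrite mulrDr.
  rewrite big_split /= -mulr_suml c1 mul0r addr0.
  under eq_bigr do rewrite /dotp mulr_sumr.
  rewrite exchange_big /= big1// => j _.
  under eq_bigr do rewrite mulrCA.
  by rewrite -mulr_sumr cY mulr0.
have t0 k : 0 <= c ord0 k * g k.
  have [ck|ck] := ltP 0 (c ord0 k); first by rewrite mulr_ge0// ltW -?cg.
  by rewrite mulr_le0// leNgt -cg -leNgt.
(* Nonnegative terms with zero sum all vanish, so no entry of [c] is positive; as the entries sum to
   zero, [c = 0], against its choice. *)
have c_le0 k : c ord0 k <= 0.
  rewrite leNgt; apply/negP => ck.
  have h k' : true -> 0 <= c ord0 k' * g k' by [].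
  have /eqP := @psumr_eq0P _ _ predT _ h s0 k isT; rewrite mulf_eq0.
  by rewrite !gt_eqF// -cg.
have : forall k, c ord0 k = 0.
  have h k : true -> 0 <= - c ord0 k by rewrite oppr_ge0.
  have sN : \sum_k - c ord0 k = 0 by rewrite sumrN c1 oppr0.
  by move=> k; have /eqP := @psumr_eq0P _ _ predT _ h sN k isT; rewrite oppr_eq0 => /eqP.
by move=> e; move/eqP: c0; apply; apply/rowP => k; rewrite mxE.
Qed.


Lemma card_pairs_neq (I : finType) (G : {set I}) :
  (\sum_(S in G) \sum_(S' in G | S' != S) 1 = #|G| * #|G|.-1)%N.
Proof.
under eq_bigr => S SG.
  rewrite sum1dep_card (_ : [set _ | _] = G :\ S); last first.
    by apply/setP => S'; rewrite !inE andbC.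
  have -> : #|G :\ S| = #|G|.-1 by rewrite (cardsD1 S G) SG.
  over.
by rewrite sum_nat_const.
Qed.

(* If all random [m]-tuples missed some symmetric difference, the union bound would give [N <= (1 - 1/k) N] for the number [N = n^m] of tuples. *)
Lemma separating_tuple n m (q : R) (G : {set {set 'I_n}}) :
  (0 < n)%N -> (0 < #|G|)%N ->
  (forall S S', S \in G -> S' \in G -> S' != S ->
    (n%:R - #|symdiff S S'|%:R : R) <= n%:R * q) -> 0 <= q ->
  #|G|%:R ^+ 2 * q ^+ m <= 1 ->
  exists t : {ffun 'I_m -> 'I_n},
    forall S S', S \in G -> S' \in G -> S' != S -> exists i, t i \in symdiff S S'.
Proof.
move=> n0 k0 sep q0 kq; apply: contrapT => nt.
pose bad S S' (t : {ffun 'I_m -> 'I_n}) := [forall i, t i \notin symdiff S S'].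
have h1 : (n ^ m <= \sum_(S in G) \sum_(S' in G | S' != S) #|[set t | bad S S' t]|)%N.
  have -> : (n ^ m = \sum_(t : {ffun 'I_m -> 'I_n}) 1)%N.
    by rewrite sum1_card card_ffun !card_ord.
  have -> : (\sum_(S in G) \sum_(S' in G | S' != S) #|[set t | bad S S' t]|
     = \sum_t \sum_(S in G) \sum_(S' in G | S' != S) bad S S' t)%N.
    rewrite exchange_big; apply: eq_bigr => S _ /=.
    rewrite exchange_big; apply: eq_bigr => S' _ /=.
    by rewrite -sum1dep_card big_mkcond; apply: eq_bigr => t _; case: bad.
  apply: leq_sum => t _; rewrite lt0n; apply/negP => /eqP t0; apply: nt; exists t.
  move=> S S' SG S'G S'S; apply/existsP; apply: contraT => /existsPn nb.
  move: t0; rewrite (bigD1 S)//= (bigD1 S')/= ?S'G// (_ : bad S S' t = true)//.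
  exact/forallP.
(* A tuple that misses a symmetric difference lies in its complement, so at most [(n q) ^ m] tuples
   are bad for one pair, a fraction at most [1 / #|G| ^ 2] of all. *)
have h2 S S' : S \in G -> S' \in G -> S' != S ->
    #|G|%:R ^+ 2 * #|[set t | bad S S' t]|%:R <= (n%:R ^+ m : R).
  move=> SG S'G S'S.
  have -> : #|[set t | bad S S' t]| = ((n - #|symdiff S S'|) ^ m)%N.
    have -> : (n - #|symdiff S S'| = #|~: symdiff S S'|)%N.
      by rewrite [RHS]cardsCs setCK card_ord.
    rewrite -[in RHS](card_ord m) -card_ffun_on -[RHS]cardsE; congr #|pred_of_set _|.
    apply/setP => t; rewrite !inE; apply/forallP/ffun_onP => h i.
      by rewrite inE h.
    by have := h i; rewrite inE.
  rewrite natrX; apply: (@le_trans _ _ (#|G|%:R ^+ 2 * (n%:R * q) ^+ m)).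
    rewrite ler_wpM2l ?sqr_ge0// lerXn2r ?nnegrE ?mulr_ge0//.
    rewrite natrB ?sep//.
    by rewrite (leq_trans (max_card _))// card_ord.
  by rewrite exprMn mulrCA ler_piMr// exprn_ge0.
have : (#|G|%:R ^+ 2 * n%:R ^+ m : R) <= (#|G| * #|G|.-1)%:R * n%:R ^+ m.
  have -> : (#|G| * #|G|.-1)%:R * n%:R ^+ m
     = \sum_(S in G) \sum_(S' in G | S' != S) (n%:R ^+ m : R).
    rewrite -card_pairs_neq natr_sum mulr_suml; apply: eq_bigr => S _.
    by rewrite natr_sum mulr_suml; apply: eq_bigr => S' _; rewrite mul1r.
  apply: (@le_trans _ _ (#|G|%:R ^+ 2 *
    (\sum_(S in G) \sum_(S' in G | S' != S) #|[set t | bad S S' t]|)%:R)).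
    by rewrite ler_wpM2l ?sqr_ge0// -natrX ler_nat.
  rewrite natr_sum mulr_sumr; apply: ler_sum => S SG.
  rewrite natr_sum mulr_sumr; apply: ler_sum => S' /andP[S'G S'S].
  exact: h2.
rewrite ler_pM2r ?exprn_gt0 ?ltr0n// -natrX ler_nat -mulnn leq_pmul2l//.
by rewrite -ltnS prednK// ltnn.
Qed.

(** A separating tuple of [m] points keeps the traces distinct, so Pajor's lemma and the VC bound
    allow at most as many members as there are sets of size at most [d] among [m] points. As [m] is
    proportional to [kap = ln #|G|], this bounds [kap] in terms of itself and [n] drops out. *)
Lemma separated_card n (y : 'I_n -> 'rV[R]_p) j (G : {set {set 'I_n}}) :
  (0 < n)%N -> (forall S, S \in G -> halfspace_cut y S) -> separated j G ->
  #|G|%:R <= expR (5 * p.+1%:R * j.+1%:R) :> R.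
Proof.
move=> n0 Gy sep; set d := p.+1.
have [G0|k0] := posnP #|G|; first by rewrite G0 expR_ge0.
pose kap : R := ln #|G|%:R.
have kE : #|G|%:R = expR kap by rewrite lnK// posrE ltr0n.
have kap0 : 0 <= kap by rewrite ln_ge0// ler1n.
have fj : 0 < (4 ^+ j : R) by rewrite exprn_gt0.
(* A length of at least [2 * kap * 4 ^ j] makes [expR (- m / 4 ^ j)] at most [#|G| ^ -2], as the
   union bound requires. *)
pose m := (Num.truncn (2 * kap * 4 ^+ j)).+1.
have m1 : 2 * kap * 4 ^+ j <= m%:R by apply/ltW/truncnS_gt.
have m2 : m%:R <= 2 * kap * 4 ^+ j + 1.
  by rewrite -(natr1 (Num.truncn _)) lerD2r truncn_le mulr_ge0 ?mulr_ge0// ltW.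
have q1 : 4 ^- j <= 1 :> R by rewrite invf_le1// exprn_ege1// ler1n.
have [t tG] : exists t : {ffun 'I_m -> 'I_n}, forall S S',
    S \in G -> S' \in G -> S' != S -> exists i, t i \in symdiff S S'.
  apply: (@separating_tuple _ _ (1 - 4 ^- j)) => //; last 2 first.
  - by rewrite subr_ge0.
  - apply: (@le_trans _ _ (#|G|%:R ^+ 2 * expR (- (4 ^- j)) ^+ m)).
      rewrite ler_wpM2l ?sqr_ge0// lerXn2r ?nnegrE ?expR_ge0 ?subr_ge0//.
      exact: expR_ge1Dx.
    rewrite kE -!expRM_natl -expRD -[leRHS]expR0 ler_expR.
    by rewrite mulrN subr_le0 ler_pdivlMr.
  - move=> S S' SG S'G S'S; rewrite mulrBr mulr1 lerD2l lerN2 ler_pdivrMr//.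
    rewrite mulrC -(natrX _ 4) -natrM ler_nat ltnW// sep//.
    by rewrite eq_sym.
pose pre (S : {set 'I_n}) := [set i | t i \in S].
have inj : {in G &, injective pre}.
  move=> S S' SG S'G e; apply/eqP; apply: contraT => SS'.
  have [i] := tG _ _ S'G SG SS'.
  move/setP: e => /(_ i); rewrite !inE => ->.
  by case: (t i \in S').
have c1 : (#|G| <= #|[set S : {set 'I_m} | (#|S| <= d)%N]|)%N.
  rewrite -(card_in_imset inj); apply: leq_trans (pajor _) _.
  apply/subset_leq_card/subsetP => S; rewrite !inE.
  apply: (@halfspace_vc _ (fun i => y (t i))) => _ /imsetP[S' S'G ->].
  by have [w [b wb]] := Gy _ S'G; exists w, b => i; rewrite inE wb.
(* With this weight [m * x] is about [kap / 2], so the right-hand side only takes back half of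
   [kap]. *)
pose x : R := 4 ^- j.+1.
have x0 : 0 < x by rewrite invr_gt0 exprn_gt0.
have xj : x = 4 ^- j / 4 by rewrite /x exprSr invfM.
have x1 : x <= 1 by rewrite xj; lra.
have c2 : #|G|%:R * x ^+ d <= (1 + x) ^+ m.
  apply: le_trans (card_small_sets m d x0 x1).
  by rewrite ler_wpM2r ?exprn_ge0 ?(ltW x0)// ler_nat.
have c3 : (1 + x) ^+ m <= expR (kap / 2 + 1 / 4).
  apply: (@le_trans _ _ (expR x ^+ m)).
    by rewrite lerXn2r ?nnegrE ?expR_ge0 ?expR_ge1Dx// addr_ge0// ltW.
  rewrite -expRM_natl ler_expR.
  apply: (@le_trans _ _ ((2 * kap * 4 ^+ j + 1) * x)).
    by rewrite ler_wpM2r// ltW.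
  have fx : 4 ^+ j * x = 1 / 4 by rewrite xj mulrA divff ?gt_eqF.
  by rewrite mulrDl -mulrA fx mul1r xj; move: q1; clear; lra.
have c4 : expR (- (2 * d%:R * j.+1%:R)) <= x ^+ d.
  have e2 : 4 <= expR 2 :> R.
    have -> : expR 2 = expR 1 ^+ 2 :> R by rewrite -expRM_natl mulr1.
    by have := expR_ge1Dx (1 : R); clear; nra.
  rewrite expRN /x exprVn -exprM.
  have -> : 2 * d%:R * j.+1%:R = (j.+1 * d)%:R * 2 :> R by rewrite natrM; ring.
  rewrite expRM_natl lef_pV2 ?posrE ?exprn_gt0 ?expR_gt0//.
  by rewrite lerXn2r ?nnegrE ?expR_ge0.
have : expR (kap - 2 * d%:R * j.+1%:R) <= expR (kap / 2 + 1 / 4).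
  apply: le_trans (le_trans c2 c3).
  by rewrite expRD -kE ler_wpM2l.
rewrite ler_expR kE ler_expR => h.
have d1 : 1 <= d%:R * j.+1%:R :> R by rewrite -natrM ler1n.
by move: h d1; rewrite -!mulrA; set z := d%:R * _; clear; lra.
Qed.

End Halfspaces.

(** * Chaining *)

Section Pairing.
Variables (R : realType) (n : nat).
Implicit Types (a e : 'I_n -> R).

Definition pairing a e : R := \sum_(i < n) e i * a i.

Lemma pairing_zmod a : zmod_morphism (pairing a).
Proof.
move=> e e'; rewrite /pairing -sumrB; apply: eq_bigr => i _.
by rewrite /= mulrBl.
Qed.

HB.instance Definition _ a :=
  GRing.isZmodMorphism.Build ('I_n -> R) R (pairing a) (pairing_zmod a).

(** Indexed by [nat] because [rade] takes a sequence of directions; the vector is zero for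
    [i >= n]. *)
Definition basis (i : nat) : 'I_n -> R := fun k => (k == i :> nat)%:R.

Lemma pairing_basis a (i : 'I_n) : pairing a (basis i) = a i.
Proof.
rewrite /pairing (bigD1 i)//= /basis eqxx mul1r big1 ?addr0// => k ki.
by rewrite (_ : (k == i :> nat) = false) ?mul0r//; apply: negbTE.
Qed.

Definition indic (S : {set 'I_n}) : 'I_n -> R := fun i => (i \in S)%:R.

Lemma sum_sqr_indicB (S S' : {set 'I_n}) :
  \sum_i (indic S i - indic S' i) ^+ 2 = #|symdiff S S'|%:R.
Proof.
rewrite -sum1_card natr_sum [RHS]big_mkcond; apply: eq_bigr => i _.
rewrite /indic !inE; case: (i \in S); case: (i \in S') => /=; ring.
Qed.

Lemma rade_expR_pairing a : rade n basis (fun e => expR (pairing a e)) 0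
  <= expR (2 * \sum_i a i ^+ 2).
Proof.
apply: le_trans (rade_expR_linear _ _ (pairing a) _) _.
by rewrite raddf0 add0r /=; under eq_bigr do rewrite pairing_basis.
Qed.

Import mathcomp.boot.fintype mathcomp.boot.finset.

(* The maximum of a family is bounded by [x <= kap - 1 + expR (x - kap)], summed over the family. *)
Lemma chain_step (A B : {set {set 'I_n}}) (r kap lam : R) (M : ('I_n -> R) -> R) :
  0 < lam ->
  (forall S, S \in B -> exists2 S', S' \in A & #|symdiff S S'|%:R <= r) ->
  2 * #|B|%:R * expR (2 * (lam ^+ 2 * r)) <= expR kap ->
  (forall e S, S \in A -> `|pairing (indic S) e| <= M e) ->
  exists M' : ('I_n -> R) -> R,
    (forall e S, S \in B -> `|pairing (indic S) e| <= M' e) /\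
    rade n basis M' 0 <= rade n basis M 0 + kap / lam.
Proof.
move=> lam0 BA Bkap AM.
have [par parP] : exists par : {set 'I_n} -> {set 'I_n}, forall S, S \in B ->
    par S \in A /\ #|symdiff S (par S)|%:R <= r.
  have /choice[par parP] : forall S, exists S', S \in B ->
      S' \in A /\ #|symdiff S S'|%:R <= r.
    move=> S; case: (boolP (S \in B)) => [/BA[S' S'A S'r]|_]; first by exists S'.
    by exists S.
  by exists par.
pose a S i := lam * (indic S i - indic (par S) i).
pose E e := \sum_(S in B) (expR (pairing (a S) e) + expR (pairing (fun i => - a S i) e)).
(* [E] has mean at most [expR kap], so the added term has mean at most [kap / lam]; [E] contains
   both signs of each link to control absolute values. *)
exists (fun e => M e + lam^-1 * ((kap - 1) + expR (- kap) * E e)); split.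
- move=> e S SB; have [pA pr] := parP S SB.
  have aE : pairing (a S) e = lam * (pairing (indic S) e - pairing (indic (par S)) e).
    rewrite /pairing -sumrB mulr_sumr; apply: eq_bigr => i _.
    by rewrite /a; ring.
  have aN : pairing (fun i => - a S i) e = - pairing (a S) e.
    by rewrite /pairing -sumrN; apply: eq_bigr => i _; rewrite mulrN.
  have E0 x : x = pairing (a S) e \/ x = - pairing (a S) e ->
      x <= kap - 1 + expR (- kap) * E e.
    move=> xE; rewrite -lerBlDl; apply: (@le_trans _ _ (expR (- kap) * expR x)).
      by rewrite -expRD; have := expR_ge1Dx (- kap + x); lra.
    rewrite ler_wpM2l ?expR_ge0// /E (bigD1 S)//= aN.
    have h : 0 <= \sum_(S' in B | S' != S)
       (expR (pairing (a S') e) + expR (pairing (fun i => - a S' i) e)).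
      by apply: sumr_ge0 => S' _; rewrite addr_ge0 ?expR_ge0.
    have := expR_ge0 (pairing (a S) e); have := expR_ge0 (- pairing (a S) e).
    by case: xE => ->; lra.
  have h : `|pairing (a S) e| <= kap - 1 + expR (- kap) * E e.
    by rewrite ler_norml lerNl; apply/andP; split; apply: E0; [right|left].
  rewrite -(subrK (pairing (indic (par S)) e) (pairing (indic S) e)) addrC.
  rewrite (le_trans (ler_normD _ _))// lerD//; first exact: AM.
  rewrite mulrC ler_pdivlMr// mulrC -{1}(gtr0_norm lam0) -normrM.
  by rewrite mulrBr -mulrBr -aE.
- rewrite radeD lerD2l radeZ radeD rade_const radeZ rade_sum.
  rewrite mulrC ler_pM2r ?invr_gt0// -lerBrDl opprB addrCA subrr addr0.
  have -> : 1 = expR (- kap) * expR kap by rewrite -expRD addNr expR0.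
  rewrite ler_wpM2l ?expR_ge0//; apply: le_trans Bkap.
  apply: (@le_trans _ _ (\sum_(S in B) (2 * expR (2 * (lam ^+ 2 * r))))); last first.
    by rewrite sumr_const -[leLHS]mulr_natr mulrAC.
  apply: ler_sum => S SB; rewrite radeD mulr_natl mulr2n.
  have [pA pr] := parP S SB.
  have h : \sum_i a S i ^+ 2 <= lam ^+ 2 * r.
    under eq_bigr do rewrite exprMn.
    by rewrite -mulr_sumr sum_sqr_indicB ler_wpM2l// sqr_ge0.
  apply: lerD; apply: le_trans (rade_expR_pairing _) _.
    by rewrite ler_expR ler_wpM2l.
  under eq_bigr do rewrite sqrrN.
  by rewrite ler_expR ler_wpM2l.
Qed.

(** A maximal separated subfamily is a net, since a member far from all of it could be added. *)
Lemma net_exists (C : {set {set 'I_n}}) j : exists B : {set {set 'I_n}},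
  [/\ B \subset C, separated j B &
   forall S, S \in C -> exists2 S', S' \in B & (4 ^ j * #|symdiff S S'| <= n)%N].
Proof.
pose P := fun B : {set {set 'I_n}} => (B \subset C) &&
  [forall S in B, forall S' in B, (S != S') ==> (n < 4 ^ j * #|symdiff S S'|)%N].
have symC (S S' : {set 'I_n}) : symdiff S S' = symdiff S' S by rewrite /symdiff setUC.
have [|B /maxsetP[/andP[BC /forall_inP Bs] Bmax]] := @ex_maxset _ P.
  exists set0; rewrite /P sub0set; apply/forall_inP => S; by rewrite inE.
have {}Bs : separated j B.
  by move=> S S' SB S'B SS'; have /forall_inP/(_ _ S'B)/implyP/(_ SS') := Bs _ SB.
exists B; split => // S SC; apply: contrapT => nS.
have {}nS S' : S' \in B -> (n < 4 ^ j * #|symdiff S S'|)%N.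
  by move=> S'B; rewrite ltnNge; apply/negP => h; apply: nS; exists S'.
have /Bmax : P (S |: B).
  rewrite /P subUset sub1set SC BC /=; apply/forall_inP => S1 /setU1P S1B.
  apply/forall_inP => S2 /setU1P S2B; apply/implyP => S12.
  case: S1B S2B S12 => [->|S1B] [->|S2B]; rewrite ?eqxx// => S12.
  - exact: nS.
  - by rewrite symC; exact: nS.
  - exact: Bs.
rewrite subsetUr => /(_ isT) SB.
have /nS : S \in B by rewrite -SB setU11.
by rewrite /symdiff setDv setU0 cards0 muln0 ltn0.
Qed.

End Pairing.

Section Chaining.
Variables (R : realType) (p n : nat) (y : 'I_n -> 'rV[R]_p).
Import mathcomp.boot.fintype mathcomp.boot.finset.
Local Notation d := (p.+1%:R : R).

(** The link at scale [j] costs [sqrt (d n)] times [(6 j + 14) / 2 ^ j]; the closed form is the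
    partial sum of this series, whose total is 40. The resolution has the factor 4 because level
    [J + 1] is the net at scale [J]. *)
Lemma chaining J : (0 < n)%N ->
  exists (A : {set {set 'I_n}}) (M : ('I_n -> R) -> R),
  [/\ forall S, halfspace_cut y S ->
        exists2 S', S' \in A & #|symdiff S S'|%:R <= 4 * n%:R / 4 ^+ J :> R,
      forall e S, S \in A -> `|pairing (indic R S) e| <= M e &
      rade n (@basis R n) M 0
        <= Num.sqrt (d * n%:R) * (40 - (12 * J%:R + 40) / 2 ^+ J)].
Proof.
move=> n0; have nR : 0 < n%:R :> R by rewrite ltr0n.
have d1 : 1 <= d by rewrite ler1n.
elim: J => [|J [A [M [AS AM Mle]]]].
  exists [set set0], (fun=> 0); split => [S _|e S /set1P ->|].
  - exists set0; rewrite ?inE// /symdiff setD0 set0D setU0 divr1.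
    have : #|S|%:R <= n%:R :> R by rewrite ler_nat -[leqRHS]card_ord max_card.
    lra.
  - by rewrite /pairing big1 ?normr0// => i _; rewrite /indic inE mulr0.
  - by rewrite rade_const mulr0 add0r divr1 subrr mulr0.
set s := Num.sqrt _ in Mle *.
have s0 : 0 < s by rewrite sqrtr_gt0 mulr_gt0//; lra.
have s2 : s ^+ 2 = d * n%:R by rewrite sqr_sqrtr// mulr_ge0//; lra.
have [B [BC Bsep Bnet]] := net_exists [set S | `[< halfspace_cut y S >]] J.
have BcutP S : S \in B -> halfspace_cut y S.
  by move=> /(subsetP BC); rewrite inE => /asboolP.
have e4 : 4 ^+ J = (2 ^+ J) ^+ 2 :> R by rewrite exprAC; congr (_ ^+ J); ring.
have e2 : 0 < 2 ^+ J :> R by rewrite exprn_gt0.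
(* This [lam] turns the variance term into [8 d], comparable with the entropy; the choice
   [d * (6 J + 14)] for [kap] covers [1 + 5 d (J + 1) + 8 d]. *)
pose lam := 2 ^+ J * d / s.
have lam0 : 0 < lam by rewrite divr_gt0// mulr_gt0//; lra.
have lamr : lam ^+ 2 * (4 * n%:R / 4 ^+ J) = 4 * d.
  rewrite /lam expr_div_n s2 exprMn e4; field.
  by rewrite !gt_eqF//; lra.
have [] := @chain_step R n A B (4 * n%:R / 4 ^+ J) (d * (6 * J%:R + 14)) lam M lam0 _ _ AM.
- by move=> S /BcutP; exact: AS.
- rewrite lamr; have := separated_card n0 BcutP Bsep.
  have e2' : 2 <= expR 1 :> R by have := expR_ge1Dx (1 : R); lra.
  move=> h; apply: (@le_trans _ _ (expR 1 * expR (5 * d * J.+1%:R) * expR (2 * (4 * d)))).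
    by rewrite ler_wpM2r ?expR_ge0// ler_pM.
  rewrite -!expRD ler_expR -natr1.
  have : 0 <= J%:R :> R by [].
  by nra.
- move=> M' [BM' M'le]; exists B, M'; split => //.
  + move=> S cS; have [|S' S'B S'n] := Bnet S; first by rewrite inE; apply/asboolP.
    exists S' => //; rewrite exprS invfM mulrACA divff// mul1r ler_pdivlMr ?exprn_gt0//.
    by rewrite mulrC -natrX -natrM ler_nat.
  + apply: le_trans M'le _; apply: le_trans (lerD Mle (lexx _)) _.
    have -> : d * (6 * J%:R + 14) / lam = s * ((6 * J%:R + 14) / 2 ^+ J).
      rewrite /lam; field; rewrite !gt_eqF//; lra.
    rewrite -mulrDr ler_pM2l// exprS -natr1 le_eqVlt; apply/orP; left; apply/eqP.
    by field; rewrite gt_eqF.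
Qed.

Lemma halfspace_rade : (0 < n)%N -> exists M : ('I_n -> R) -> R,
  (forall e S, halfspace_cut y S -> `|pairing (indic R S) e| <= M e) /\
  rade n (@basis R n) M 0 <= 40 * Num.sqrt (d * n%:R).
Proof.
(* At this level the distance is at most [n / 4 ^ n < 1], hence zero: the chain ends at the cut
   itself and leaves no remainder. *)
move=> n0; have [A [M [AS AM Mle]]] := chaining n.+1 n0.
exists M; split => [e S /AS[S' S'A]|].
- rewrite exprS invfM mulrACA divff// mul1r ler_pdivlMr ?exprn_gt0//.
  rewrite -natrX -natrM ler_nat => h.
  have SS' : #|symdiff S S'| = 0%N.
    have := ltn_expl n (isT : 1 < 4)%N; move: h.
    by case: #|_| => // k; nia.
  suff -> : S = S' by exact: AM.
  move/eqP: SS'; rewrite cards_eq0 /symdiff setU_eq0 !setD_eq0.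
  by move=> ?; apply/eqP; rewrite eqEsubset.
- apply: le_trans Mle _; rewrite mulrC ler_wpM2r ?sqrtr_ge0//.
  by rewrite gerBl divr_ge0 ?exprn_ge0// addr_ge0// mulr_ge0.
Qed.

End Chaining.

(** * Networks at fixed sample points *)

Local Open Scope classical_set_scope.
Local Open Scope ring_scope.

Section Sigmoid.
Variable R : realType.
Implicit Types u t : R.

Lemma sigmoid_gt0 u : 0 < sigmoid u.
Proof. by rewrite divr_gt0// addr_gt0// expR_gt0. Qed.

Lemma sigmoid_le1 u : sigmoid u <= 1.
Proof. by rewrite ler_pdivrMr ?addr_gt0 ?expR_gt0// mul1r lerDl expR_ge0. Qed.

(** Superlevel sets of a sigmoid node are therefore halfspaces, the level being absorbed in the
    offset. *)
Lemma sigmoid_gt u t : 0 < t -> t < 1 ->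
  (t < sigmoid u) = (0 < u + ln ((1 - t) / t)).
Proof.
move=> t0 t1; have q0 : 0 < (1 - t) / t by rewrite divr_gt0// subr_gt0.
have -> : (0 < u + ln ((1 - t) / t)) = (- u < ln ((1 - t) / t)).
  by rewrite -[RHS]subr_gt0 opprK addrC.
rewrite -[RHS]ltr_expR lnK ?posrE// [RHS]ltr_pdivlMr// ltrBrDl.
rewrite /sigmoid ltr_pdivlMr; last by rewrite addr_gt0// expR_gt0.
by rewrite mulrDr mulr1 [t * _]mulrC.
Qed.

Lemma is_derive_sigmoid u :
  is_derive u 1 (@sigmoid R) (sigmoid u * (1 - sigmoid u)).
Proof.
have e0 : 1 + expR (- u) != 0 by rewrite gt_eqF// addr_gt0// expR_gt0.
have -> : @sigmoid R = (fun v => (1 + expR (- v))^-1).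
  by apply/funext => v; rewrite /sigmoid div1r.
have h : is_derive u 1 (fun v : R => 1 + expR (- v)) (0 + expR (- u) * (- 1)).
  by apply: is_deriveD.
have := @is_deriveV R (fun v => 1 + expR (- v)) u _ 1 e0 h.
rewrite add0r /GRing.scale /= mulrN1 mulrNN => /is_derive_eq; apply.
by rewrite /sigmoid; field.
Qed.

(** The derivative [s (1 - s)] is at most 1/4. *)
Lemma sigmoid_lip u v : `|sigmoid u - sigmoid v| <= 4^-1 * `|u - v|.
Proof.
wlog uv : u v / v <= u.
  by move=> h; have [/h//|/ltW/h] := leP v u; rewrite distrC [`|v - u|]distrC.
have [c _ ->] : exists2 c, c \in `[v, u]%R & sigmoid u - sigmoid v =
    sigmoid c * (1 - sigmoid c) * (u - v).
  apply: MVT_segment => // [x _|]; first exact: is_derive_sigmoid.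
  apply: continuous_subspaceT => x; apply: differentiable_continuous.
  by apply/derivable1_diffP; have [] := is_derive_sigmoid x.
have s0 := sigmoid_gt0 c; have s1 := sigmoid_le1 c.
rewrite normrM ger0_norm ?mulr_ge0 ?subr_ge0 ?(ltW s0)//.
by rewrite ler_wpM2r//; have := sqr_ge0 (sigmoid c - 1 / 2); lra.
Qed.

End Sigmoid.

Lemma ReLU_lip (R : realType) (u v : R) : `|ReLU u - ReLU v| <= `|u - v|.
Proof.
rewrite /ReLU; case: (ltP u 0) => u0; case: (ltP v 0) => v0.
- by rewrite subrr normr0.
- by rewrite sub0r normrN ger0_norm// distrC ger0_norm; lra.
- by rewrite subr0 ger0_norm// ger0_norm; lra.
- by [].
Qed.

Lemma count_lt (R : realType) (x : R) N : 0 <= x ->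
  Num.min x N%:R <= \sum_(k < N) (k%:R < x :> R)%:R /\
  \sum_(k < N) (k%:R < x :> R)%:R <= x + 1.
Proof.
move=> x0; have cN m : \sum_(k < m) (k%:R < x :> R)%:R <= m%:R :> R.
  elim: m => [|m IH]; first by rewrite big_ord0.
  by rewrite big_ord_recr /= -natr1 lerD//; case: ltP.
elim: N => [|N [IH1 IH2]].
  by rewrite big_ord0 ge_min lexx orbT addr_ge0.
move: IH1 IH2 (cN N); rewrite !big_ord_recr /= -natr1.
have [Nx|xN] := ltP N%:R x; rewrite /= ?addr0 => h1 h2 h3.
- split; last by lra.
  by rewrite ge_min lerD2r h1 orbT.
- by split => //; rewrite ge_min h1.
Qed.

(* Riemann sums of the layer-cake formula [v = \int_0^1 [t < v] dt]. *)
Lemma layer_cake (R : realType) n (e v : 'I_n -> R) (M : R) :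
  (forall i, 0 <= v i <= 1) ->
  (forall t, 0 <= t < 1 ->
    `|pairing (indic R [set i | t < v i]%SET) e| <= M) ->
  `|pairing v e| <= M.
Proof.
move=> v01 hM; apply/ler_addgt0Pr => eps eps0.
pose s := \sum_i `|e i|.
have s0 : 0 <= s by apply: sumr_ge0.
pose N := (Num.truncn (s / eps)).+1.
have N0 : 0 < N%:R :> R by rewrite ltr0n.
have sN : s / N%:R <= eps.
  by rewrite ler_pdivrMr// mulrC -ler_pdivrMr// ltW// truncnS_gt.
pose r i : R := N%:R^-1 * \sum_(k < N) (k%:R / N%:R < v i :> R)%:R.
have rv i : `|v i - r i| <= N%:R^-1.
  have /andP[v0 v1] := v01 i.
  have [] := count_lt N (mulr_ge0 v0 (ltW N0)).
  rewrite (_ : Num.min _ _ = v i * N%:R); last first.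
    by apply: min_l; rewrite ler_piMl// ltW.
  have -> : \sum_(k < N) (k%:R < v i * N%:R :> R)%:R = N%:R * r i :> R.
    rewrite mulrA divff ?gt_eqF// mul1r; apply: eq_bigr => k _.
    by rewrite ltr_pdivrMr.
  rewrite mulrC ler_pM2l// => h1.
  rewrite -ler_pdivlMl// mulrDr mulrA mulVf ?gt_eqF// mul1r mulr1 => h2.
  by rewrite ler_distl; apply/andP; split; lra.
have -> : pairing v e = pairing r e + \sum_i e i * (v i - r i).
  by rewrite -big_split; apply: eq_bigr => i _ /=; rewrite -mulrDr subrKC.
rewrite (le_trans (ler_normD _ _))// lerD//.
- have -> : pairing r e = N%:R^-1 *
      \sum_(k < N) pairing (indic R [set i | k%:R / N%:R < v i]%SET) e.
    rewrite /pairing exchange_big mulr_sumr; apply: eq_bigr => i _ /=.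
    rewrite /r mulrCA mulr_sumr; congr (_ * _); apply: eq_bigr => k _.
    by rewrite /indic inE.
  rewrite normrM ger0_norm ?invr_ge0 ?(ltW N0)// ler_pdivrMl//.
  rewrite (le_trans (ler_norm_sum _ _ _))//.
  rewrite (_ : N%:R * M = \sum_(k < N) M); last by rewrite sumr_const card_ord mulr_natl.
  apply: ler_sum => k _; apply: hM.
  by rewrite divr_ge0 ?(ltW N0)//= ltr_pdivrMr// mul1r ltr_nat.
- apply: le_trans sN; rewrite (le_trans (ler_norm_sum _ _ _))// mulr_suml.
  by apply: ler_sum => i _; rewrite normrM ler_wpM2l.
Qed.

(** * Size and regularity of networks *)

Section Networks.
Variables (R : realType) (p : nat).
Implicit Types (f g : 'rV[R]_p -> R) (w x y : 'rV[R]_p).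

Lemma norm2_ge0 x : 0 <= norm2 x. Proof. exact: sqrtr_ge0. Qed.

Lemma norm2_sqr x : norm2 x ^+ 2 = \sum_i x ord0 i ^+ 2.
Proof. by rewrite sqr_sqrtr// sumr_ge0// => i _; exact: sqr_ge0. Qed.

Lemma norm2_0 : norm2 (0 : 'rV[R]_p) = 0.
Proof. by rewrite /norm2 big1 ?sqrtr0// => i _; rewrite mxE expr0n. Qed.

Lemma dotpB w x y : dotp w (x - y) = dotp w x - dotp w y.
Proof. by rewrite /dotp -sumrB; apply: eq_bigr => i _; rewrite !mxE mulrBr. Qed.

(** Cauchy-Schwarz from [2 a b |w_i x_i| <= b^2 w_i^2 + a^2 x_i^2]. Dividing by [a b] needs positive
    numbers, so the norms are first enlarged by [eps]. *)
Lemma dotp_le w x : `|dotp w x| <= norm2 w * norm2 x.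
Proof.
have key a b : 0 < a -> 0 < b -> norm2 w <= a -> norm2 x <= b -> `|dotp w x| <= a * b.
  move=> a0 b0 wa xb; rewrite (le_trans (ler_norm_sum _ _ _))//.
  have w2 : \sum_i w ord0 i ^+ 2 <= a ^+ 2.
    by rewrite -norm2_sqr lerXn2r ?nnegrE ?norm2_ge0// ltW.
  have x2 : \sum_i x ord0 i ^+ 2 <= b ^+ 2.
    by rewrite -norm2_sqr lerXn2r ?nnegrE ?norm2_ge0// ltW.
  have ab0 : 0 < 2 * a * b by rewrite !mulr_gt0.
  rewrite -(ler_pM2l ab0) mulr_sumr.
  apply: (@le_trans _ _ (\sum_i (b ^+ 2 * w ord0 i ^+ 2 + a ^+ 2 * x ord0 i ^+ 2))).
    apply: ler_sum => i _; rewrite normrM.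
    have := sqr_ge0 (b * `|w ord0 i| - a * `|x ord0 i|).
    rewrite -(real_normK (num_real (w ord0 i))) -(real_normK (num_real (x ord0 i))).
    by nra.
  rewrite big_split -!mulr_sumr /=.
  have b2 : 0 <= b ^+ 2 := sqr_ge0 b; have a2 : 0 <= a ^+ 2 := sqr_ge0 a.
  by nra.
have h eps : 0 < eps -> `|dotp w x| <= (norm2 w + eps) * (norm2 x + eps).
  by move=> e0; apply: key; rewrite ?lerDl ?(ltW e0)//; have := norm2_ge0 w; have := norm2_ge0 x; lra.
apply/ler_addgt0Pr => e e0.
have s0 : 0 <= norm2 w + norm2 x by rewrite addr_ge0 ?norm2_ge0.
pose t := Num.min 1 (e / (norm2 w + norm2 x + 1)).
have t0 : 0 < t by rewrite lt_min ltr01 divr_gt0//; lra.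
have t1 : t <= 1 by rewrite ge_min lexx.
have t2 : t * (norm2 w + norm2 x + 1) <= e.
  by rewrite -ler_pdivlMr ?ge_min ?lexx ?orbT//; lra.
by have := h t t0; nra.
Qed.

Lemma hull_bound d (w : 'I_d -> R) (a : 'I_d -> R) M : 0 <= M ->
  \sum_i `|w i| <= 1 -> (forall i, `|a i| <= M) -> `|\sum_i w i * a i| <= M.
Proof.
move=> M0 w1 aM; rewrite (le_trans (ler_norm_sum _ _ _))//.
apply: (@le_trans _ _ ((\sum_i `|w i|) * M)).
  by rewrite mulr_suml; apply: ler_sum => i _; rewrite normrM ler_wpM2l.
by rewrite ler_piMl.
Qed.

Lemma hull_lip d (w : 'I_d -> R) (a b : 'I_d -> R) M : 0 <= M ->
  \sum_i `|w i| <= 1 -> (forall i, `|a i - b i| <= M) ->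
  `|\sum_i w i * a i - \sum_i w i * b i| <= M.
Proof.
move=> M0 w1 abM; rewrite -sumrB; under eq_bigr do rewrite -mulrBr.
exact: hull_bound.
Qed.

(** The common form of the output layer and of the argument of each ReLU node; [Dnet B L] unfolds to
    [hull (layer_nodes B L.-1)], so facts on hulls apply to it directly. *)
Definition hull (T : set ('rV[R]_p -> R)) : set ('rV[R]_p -> R) :=
  [set f | exists (d : nat) (w : 'I_d -> R) (g : 'I_d -> 'rV[R]_p -> R),
      (0 < d)%N /\ (forall i, T (g i)) /\
      \sum_(i < d) `|w i| <= 1 /\
      f = (fun x => \sum_(i < d) w i * g i x)].

Lemma layer_nodesSS B l f : layer_nodes B l.+2 f <->
  exists2 h, hull (layer_nodes B l.+1) h & f = @ReLU R \o h.
Proof.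
split=> [[d [w [g [d0 [gT [w1 ->]]]]]]|[h [d [w [g [d0 [gT [w1 ->]]]]]] ->]].
  by exists (fun x => \sum_i w i * g i x) => //; exists d, w, g.
by exists d, w, g.
Qed.

Lemma layer_nodes_le1 B l f x : layer_nodes B l f -> `|f x| <= 1.
Proof.
case: l => // l; elim: l f => [|l IH] f.
  move=> [w [b [_ ->]]]; rewrite ger0_norm ?sigmoid_le1//.
  exact/ltW/sigmoid_gt0.
move=> /layer_nodesSS[h [d [w [g [_ [gT [w1 ->]]]]]] ->] /=.
have := ReLU_lip (\sum_i w i * g i x) 0; rewrite /ReLU maxxx !subr0 => /le_trans; apply.
by apply: hull_bound => // i; exact: IH.
Qed.

Lemma layer_nodes_lip B l f x y : 0 <= B -> layer_nodes B l f ->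
  `|f x - f y| <= B / 4 * norm2 (x - y).
Proof.
move=> B0; case: l => // l; elim: l f => [|l IH] f.
  move=> [w [b [wB ->]]]; apply: le_trans (sigmoid_lip _ _) _.
  have -> : dotp w x + b - (dotp w y + b) = dotp w (x - y) by rewrite dotpB; ring.
  rewrite mulrC mulrAC ler_wpM2r ?invr_ge0//.
  by rewrite (le_trans (dotp_le _ _))// ler_wpM2r// norm2_ge0.
move=> /layer_nodesSS[h [d [w [g [_ [gT [w1 ->]]]]]] ->] /=.
apply: le_trans (ReLU_lip _ _) _; apply: hull_lip => // [|i].
  by rewrite mulr_ge0 ?norm2_ge0// divr_ge0.
exact: IH.
Qed.

Lemma Dnet_le1 B L f x : Dnet B L f -> `|f x| <= 1.
Proof.
move=> [d [w [g [_ [gT [w1 ->]]]]]].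
by apply: hull_bound => // i; exact: layer_nodes_le1 (gT i).
Qed.

Lemma Dnet_lip B L f x y : 0 <= B -> Dnet B L f ->
  `|f x - f y| <= B / 4 * norm2 (x - y).
Proof.
move=> B0 [d [w [g [_ [gT [w1 ->]]]]]]; apply: hull_lip => // [|i].
  by rewrite mulr_ge0 ?norm2_ge0// divr_ge0.
exact: layer_nodes_lip (gT i).
Qed.

Lemma Dnet_opp B L f : Dnet B L f -> Dnet B L (fun x => - f x).
Proof.
move=> [d [w [g [d0 [gT [w1 ->]]]]]].
exists d, (fun i => - w i), g; split => //; split => //; split.
  by under eq_bigr do rewrite normrN.
by apply/funext => x; rewrite -sumrN; apply: eq_bigr => i _; rewrite mulNr.
Qed.

Lemma hull_nonempty T : T !=set0 -> hull T !=set0.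
Proof.
move=> [g gT]; exists (fun x => \sum_(i < 1) 0 * g x).
exists 1%N, (fun=> 0), (fun=> g); split => //; split => //; split => //.
by rewrite big1// => i _; rewrite normr0.
Qed.

Lemma hull0 T : T !=set0 -> hull T (fun=> 0).
Proof.
move=> [g gT]; exists 1%N, (fun=> 0), (fun=> g); split => //; split => //; split.
  by rewrite big1// => i _; rewrite normr0.
by apply/funext => x; rewrite big1// => i _; rewrite mul0r.
Qed.

Lemma layer_nodes_nonempty B l : 0 < B -> @layer_nodes R p B l.+1 !=set0.
Proof.
move=> B0; elim: l => [|l IH].
  by exists (fun x => sigmoid (dotp 0 x + 0)), 0, 0; rewrite norm2_0 ltW.
exists (@ReLU R \o fun=> 0); apply/layer_nodesSS.
by exists (fun=> 0) => //; exact: hull0.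
Qed.

(** * Rademacher complexity of the layers *)

Section Sample.
Variables (n : nat) (y : nat -> 'rV[R]_p).

Definition at_sample f : 'I_n -> R := fun i => f (y i).

Definition sup_abs (T : set ('rV[R]_p -> R)) (e : 'I_n -> R) : R :=
  sup [set `|pairing (at_sample f) e| | f in T].

Definition le1 (T : set ('rV[R]_p -> R)) := forall f x, T f -> `|f x| <= 1.

Lemma bounded_pairing T e : le1 T -> bounded_on T (fun f => pairing (at_sample f) e).
Proof.
move=> T1; exists (\sum_i `|e i|) => f Tf.
rewrite (le_trans (ler_norm_sum _ _ _))//; apply: ler_sum => i _.
by rewrite normrM ler_piMr// T1.
Qed.

Lemma bounded_pairing_norm T e : le1 T ->
  bounded_on T (fun f => `|pairing (at_sample f) e|).
Proof. by move=> /(@bounded_pairing _ e)[M hM]; exists M => f Tf; rewrite normr_id hM. Qed.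

Lemma sup_abs_ub T e f : le1 T -> T f -> `|pairing (at_sample f) e| <= sup_abs T e.
Proof. by move=> T1 Tf; apply: (bounded_sup_ub (bounded_pairing_norm e T1)). Qed.

Lemma le1_hull T : le1 T -> le1 (hull T).
Proof.
move=> T1 f x [d [w [g [_ [gT [w1 ->]]]]]].
by apply: hull_bound => // i; exact: T1.
Qed.

(** The pairing is linear in the function, so mixing nodes costs nothing. *)
Lemma sup_abs_hull T e : T !=set0 -> le1 T -> sup_abs (hull T) e <= sup_abs T e.
Proof.
move=> T0 T1; apply: sup_le_bound; first exact: hull_nonempty.
move=> f [d [w [g [_ [gT [w1 ->]]]]]].
have -> : pairing (at_sample (fun x => \sum_i w i * g i x)) e =
    \sum_i w i * pairing (at_sample (g i)) e.
  rewrite /pairing; under [RHS]eq_bigr do rewrite mulr_sumr.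
  rewrite exchange_big; apply: eq_bigr => i _ /=.
  by rewrite mulr_sumr; apply: eq_bigr => k _; rewrite mulrCA.
apply: hull_bound => // [|i]; last exact: sup_abs_ub.
by case: T0 => h hT; apply: le_trans (sup_abs_ub e T1 hT).
Qed.

(** Contraction concerns one-sided suprema. Zero belongs to the hull, so the one-sided suprema at
    [e] and [- e] are nonnegative and their sum dominates the two-sided one; their means agree by
    symmetry of the signs, whence the factor 2. *)
Lemma rade_ReLU T : T !=set0 -> le1 T ->
  rade n (@basis R n) (sup_abs [set @ReLU R \o h | h in hull T]) 0
  <= 2 * rade n (@basis R n) (sup_abs T) 0.
Proof.
move=> T0 T1; pose H := hull T.
have H0 : H !=set0 by exact: hull_nonempty.
have H1 : le1 H by exact: le1_hull.
pose rl (h : 'rV[R]_p -> R) := @ReLU R \o h.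
pose S e := sup [set pairing (at_sample (rl h)) e | h in H].
have bS e : bounded_on H (fun h => pairing (at_sample (rl h)) e).
  have h1 : le1 [set rl h | h in H].
    move=> _ x [h Hh <-]; have := ReLU_lip (h x) 0.
    by rewrite /ReLU maxxx !subr0 => /le_trans; apply; exact: H1.
  have [M hM] := bounded_pairing e h1.
  by exists M => h Hh; apply: hM; exists h.
have S0 e : 0 <= S e.
  apply: le_trans (bounded_sup_ub (bS e) (hull0 T0)).
  rewrite /pairing big1// => i _.
  by rewrite /at_sample /rl /= /ReLU maxxx mulr0.
have h1 e : sup_abs [set rl h | h in H] e <= S e + S (- e).
  apply: sup_le_bound; first by case: H0 => h Hh; exists (rl h), h.
  move=> _ [h Hh <-]; rewrite ler_norml.
  have s1 := bounded_sup_ub (bS e) Hh; have s2 := bounded_sup_ub (bS (- e)) Hh.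
  rewrite -/(S e) in s1; rewrite -/(S (- e)) in s2.
  rewrite raddfN in s2; have := S0 e; have := S0 (- e); move: s1 s2.
  by rewrite /=; lra.
apply: le_trans (rade_le _ _ _ h1) _.
rewrite radeD rade_opp oppr0.
suff : rade n (@basis R n) S 0 <= rade n (@basis R n) (sup_abs T) 0 by lra.
pose F (c : ('rV[R]_p -> R) -> R) := sup [set c h | h in H].
(* [L phi] sends a sign vector to a process over the functions [h], the form that [rade_contraction]
   requires. *)
pose L (phi : R -> R) (e : 'I_n -> R) : ('rV[R]_p -> R) -> R :=
  fun h => pairing (at_sample (phi \o h)) e.
have LB phi : zmod_morphism (L phi).
  by move=> e e'; apply/funext => h; exact: raddfB.
have L0 phi : L phi 0 = 0 by apply/funext => h; exact: raddf0.
have Lb phi i : (i < n)%N -> L phi (basis R i) = fun h => phi (h (y i)).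
  by move=> ni; apply/funext => h; exact: (pairing_basis _ (Ordinal ni)).
have -> : rade n (@basis R n) S 0 =
    rade n (fun i h => ReLU (h (y i))) F 0.
  rewrite -(L0 (@ReLU R)) -(eq_rade _ _ (fun i ni => Lb (@ReLU R) i ni)).
  by rewrite -rade_comp.
apply: (@le_trans _ _ (rade n (fun i h => h (y i)) F 0)).
  apply: (@rade_contraction R _ H H0 (@ReLU R) n (fun i h => h (y i)) 0) => //.
  - exact: ReLU_lip.
  - by move=> i; exists 1 => h; exact: H1.
  - by exists 0 => h _; rewrite normr0.
have -> : rade n (fun i h => h (y i)) F 0 = rade n (@basis R n) (fun e => F (L id e)) 0.
  by rewrite rade_comp// L0; apply: eq_rade => i ni; rewrite Lb.
apply: rade_le => e; apply: le_trans (sup_abs_hull e T0 T1).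
apply: sup_le_bound => // h Hh; apply: le_trans (ler_norm _) _.
exact: sup_abs_ub.
Qed.

Lemma rade_layer B l : (0 < n)%N -> 0 < B ->
  rade n (@basis R n) (sup_abs (layer_nodes B l.+1)) 0
  <= 2 ^+ l * (40 * Num.sqrt (p.+1%:R * n%:R)).
Proof.
move=> n0 B0; elim: l => [|l IH].
  rewrite mul1r; have [M [hM Mle]] := halfspace_rade (fun i : 'I_n => y i) n0.
  apply: le_trans Mle; apply: rade_le => e; apply: sup_le_bound.
    exact: layer_nodes_nonempty.
  move=> _ [w [b [_ ->]]]; apply: layer_cake => [i|t /andP[t0 t1]].
    by rewrite /at_sample sigmoid_le1 ltW ?sigmoid_gt0.
  (* [sigmoid_gt] excludes level 0, where the cut is the whole sample; the constant 1 is a halfspace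
     that gives it. *)
  apply: hM; move: t0; rewrite le_eqVlt => /orP[/eqP <-|t0].
    exists 0, 1 => i; rewrite inE sigmoid_gt0 /dotp big1 ?add0r ?ltr01// => k _.
    by rewrite mxE mul0r.
  exists w, (b + ln ((1 - t) / t)) => i.
  by rewrite inE sigmoid_gt// addrA.
have -> : layer_nodes B l.+2 = [set @ReLU R \o h | h in hull (layer_nodes B l.+1)].
  apply/seteqP; split => [f /layer_nodesSS[h Hh ->]|f [h Hh <-]]; first by exists h.
  by apply/layer_nodesSS; exists h.
apply: le_trans (rade_ReLU _ _) _; first exact: layer_nodes_nonempty.
  by move=> f x; exact: layer_nodes_le1.
by rewrite exprS -mulrA ler_pM2l.
Qed.

Lemma sup_abs_bounded_diff T e i : T !=set0 -> le1 T ->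
  `|sup_abs T (e + basis R i) - sup_abs T (e - basis R i)| <= 2.
Proof.
move=> T0 T1.
have b1 f : T f -> `|pairing (at_sample f) (basis R i)| <= 1.
  move=> Tf; have [ni|ni] := ltnP i n.
    by rewrite (pairing_basis _ (Ordinal ni)) T1.
  rewrite /pairing big1 ?normr0// => k _; rewrite /basis.
  by rewrite (_ : (_ == _) = false) ?mul0r//; apply/negbTE; rewrite neq_ltn (leq_trans _ ni).
rewrite ler_distl; apply/andP; split.
- rewrite lerBlDr; apply: sup_le_bound => // f Tf.
  have := sup_abs_ub (e + basis R i) T1 Tf; have := b1 f Tf.
  rewrite raddfD raddfB /=; set a := pairing _ e; set b := pairing _ _.
  have := ler_normD (a + b) (- (b + b)); have := ler_normD b b.
  by rewrite normrN [a + b + _](_ : _ = a - b); [lra|ring].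
- apply: sup_le_bound => // f Tf.
  have := sup_abs_ub (e - basis R i) T1 Tf; have := b1 f Tf.
  rewrite raddfB raddfD /=; set a := pairing _ e; set b := pairing _ _.
  have := ler_normD (a - b) (b + b); have := ler_normD b b.
  by rewrite [a - b + _](_ : _ = a + b); [lra|ring].
Qed.

Lemma rade_expR_Dnet B L lam : (0 < n)%N -> 0 < B -> (2 <= L)%N -> 0 <= lam ->
  rade n (@basis R n) (fun e => expR (lam * sup_abs (Dnet B L) e)) 0 <=
  expR (lam * (2 ^+ L * (40 * Num.sqrt (p.+1%:R * n%:R))) + 2 * n%:R * lam ^+ 2).
Proof.
case: L => [|[|L]]// n0 B0 _ lam0.
have Tn : @layer_nodes R p B L.+1 !=set0 by exact: layer_nodes_nonempty.
have T1 : le1 (@layer_nodes R p B L.+1) by move=> f x; exact: layer_nodes_le1.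
apply: (@le_trans _ _ _ _ _ (rade_expR_bounded_diff n 0 (b := lam) _)).
  move=> i e; rewrite -mulrBr normrM ger0_norm// mulrC ler_wpM2r//.
  by apply: sup_abs_bounded_diff; [exact: hull_nonempty|exact: le1_hull].
rewrite ler_expR lerD2r radeZ ler_wpM2l//.
apply: le_trans (rade_le _ _ _ (fun e => sup_abs_hull e Tn T1)) _.
apply: le_trans (rade_layer _ n0 B0) _.
(* After the case split the depth is [L + 2], and the layers give only [2 ^+ L]. *)
rewrite ler_wpM2r ?mulr_ge0 ?sqrtr_ge0// ler_weXn2l ?ler1n//.
by rewrite -addn2 leq_addr.
Qed.

End Sample.
End Networks.

(** * Symmetrization on a finite probability space *)

(* Expectation of [F (v + \sum_(i < m) z k_i)] for independent [k_i] of law [q]. *)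
Fixpoint iid (R : realType) (V : zmodType) (K : finType) (q : K -> R)
    (z : K -> V) (m : nat) (F : V -> R) (v : V) : R :=
  if m is m'.+1 then \sum_k q k * iid q z m' F (v + z k) else F v.

Lemma sum_ffun_recl (R : realType) (K : finType) m (G : {ffun 'I_m.+1 -> K} -> R) :
  \sum_f G f = \sum_a \sum_(g : {ffun 'I_m -> K})
    G [ffun i => if unlift ord0 i is Some j then g j else a].
Proof.
rewrite pair_big /=.
pose h (ag : K * {ffun 'I_m -> K}) : {ffun 'I_m.+1 -> K} :=
  [ffun i => if unlift ord0 i is Some j then ag.2 j else ag.1].
rewrite (reindex h)//=; exists (fun f => (f ord0, [ffun j => f (lift ord0 j)])).
- move=> [a g] _; rewrite /h /=; congr (_, _); first by rewrite ffunE unlift_none.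
  by apply/ffunP => j; rewrite !ffunE liftK.
- move=> f _; apply/ffunP => i; rewrite ffunE /=.
  by case: unliftP => [j|] -> //; rewrite ffunE.
Qed.

Section Iid.
Variables (R : realType) (V : zmodType).
Implicit Types (F : V -> R) (v : V).

Lemma iidE (K : finType) (q : K -> R) (z : K -> V) m F v :
  \sum_(f : {ffun 'I_m -> K}) (\prod_i q (f i)) * F (v + \sum_i z (f i))
    = iid q z m F v.
Proof.
elim: m v => [|m IH] v.
  rewrite (eq_bigr (fun=> F v)); last by move=> f _; rewrite !big_ord0 mul1r addr0.
  by rewrite sumr_const card_ffun card_ord expn0 mulr1n.
rewrite sum_ffun_recl /=; apply: eq_bigr => a _; rewrite -IH mulr_sumr.
apply: eq_bigr => g _; rewrite !big_ord_recl !ffunE unlift_none -mulrA addrA.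
congr (_ * (_ * F (_ + _))); apply: eq_bigr => i _; by rewrite ffunE liftK.
Qed.

Section Symmetrization.
Variables (K : finType) (q : K -> R) (z : K -> V).
Hypothesis q0 : forall k, 0 <= q k.
Hypothesis q1 : \sum_k q k = 1.

Let q2 (k : K * K) := q k.1 * q k.2.
Let z2 (k : K * K) := z k.1 - z k.2.

(** Jensen's inequality replaces each mean by an independent copy. The hypothesis concerns a single
    shift; the other summands are shifts too, so it passes through the recursion. *)
Lemma iid_le_centered (mu : V) m F v :
  (forall x, F (x - mu) <= \sum_k q k * F (x - z k)) ->
  iid q (fun k => z k - mu) m F v <= iid q2 z2 m F v.
Proof.
move=> Fmu; elim: m v => [//|m IH] v /=.
have jensen x : iid q (fun k => z k - mu) m F (x - mu)
    <= \sum_k q k * iid q (fun k => z k - mu) m F (x - z k).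
  elim: m x {IH} => [|m IH] x /=; first exact: Fmu.
  under [leRHS]eq_bigr do rewrite mulr_sumr.
  rewrite exchange_big /=; apply: ler_sum => a _.
  under [leRHS]eq_bigr do rewrite mulrCA.
  rewrite -mulr_sumr ler_wpM2l// addrAC; apply: le_trans (IH _) _.
  by under eq_bigr do rewrite addrAC.
apply: (@le_trans _ _ (\sum_a q a * \sum_k q k *
    iid q (fun k => z k - mu) m F (v + z a - z k))).
  by apply: ler_sum => a _; rewrite ler_wpM2l// addrA.
under [leLHS]eq_bigr do rewrite mulr_sumr.
rewrite pair_big /=; apply: ler_sum => -[a k] _; rewrite mulrA -addrA.
by rewrite ler_wpM2l// mulr_ge0.
Qed.

Lemma sum_z2_sym (G : V -> R) :
  \sum_k q2 k * G (z2 k) = \sum_k q2 k * ((G (z2 k) + G (- z2 k)) / 2).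
Proof.
have e : \sum_k q2 k * G (z2 k) = \sum_k q2 k * G (- z2 k).
  have sw : bijective (fun k : K * K => (k.2, k.1)).
    by exists (fun k => (k.2, k.1)) => -[].
  rewrite (reindex _ (onW_bij _ sw)) /=.
  by apply: eq_bigr => k _; rewrite /q2 /z2 /= [q k.2 * _]mulrC opprB.
under [RHS]eq_bigr do rewrite mulrA mulrDr.
by rewrite -mulr_suml big_split /= -e; lra.
Qed.

(** A difference [z2] is symmetric in law, so a random sign can be inserted for free; the average
    over pairs is then bounded by the worst sequence of pairs. *)
Lemma iid_sym_le m F v b :
  (forall k : nat -> K * K, rade m (fun i => z2 (k i)) F v <= b) ->
  iid q2 z2 m F v <= b.
Proof.
have [k0 _] : exists k : K, true.
  apply: contrapT => nk; have := q1; rewrite big1; last by move=> k; case: nk; exists k.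
  by move=> /eqP; rewrite eq_sym oner_eq0.
elim: m F v => [|m IH] F v hb; first exact: (hb (fun=> (k0, k0))).
rewrite /= (sum_z2_sym (fun x => iid q2 z2 m F (v + x))).
have q21 : \sum_k q2 k = 1.
  by rewrite -(pair_big xpredT xpredT (fun a k => q a * q k)) /= -[RHS]q1;
    apply: eq_bigr => a _; rewrite -mulr_sumr q1 mulr1.
apply: (@le_trans _ _ (\sum_k q2 k * b)); last by rewrite -mulr_suml q21 mul1r.
apply: ler_sum => k _.
rewrite ler_wpM2l ?mulr_ge0//=.
have -> : (iid q2 z2 m F (v + z2 k) + iid q2 z2 m F (v - z2 k)) / 2 =
    iid q2 z2 m (fun x => (F (x + z2 k) + F (x - z2 k)) / 2) v.
  elim: m v {IH hb} => [//|m IH] v /=; rewrite -big_split mulr_suml /=.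
  apply: eq_bigr => a _; rewrite -mulrDr -mulrA; congr (_ * _).
  by rewrite -IH addrAC [v + z2 a - _]addrAC.
apply: IH => k'; rewrite -rade_avg.
(* The pair [k] just drawn is put at index [m] of the sequence. *)
have := hb (fun i => if (i < m)%N then k' i else k); rewrite /= ltnn.
by rewrite !(@eq_rade _ _ m (fun i => z2 (if (i < m)%N then k' i else k)) (fun i => z2 (k' i))) // => i ->.
Qed.

Lemma rade_sub_le m (u1 u2 : nat -> V) F A B x y :
  (forall a b, F (a - b) <= A a + B b) ->
  rade m (fun i => u1 i - u2 i) F (x - y) <= rade m u1 A x + rade m u2 B y.
Proof.
move=> FAB; elim: m x y => [|m IH] x y /=; first exact: FAB.
have := IH (x + u1 m) (y + u2 m); have := IH (x - u1 m) (y - u2 m).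
have -> : x - u1 m - (y - u2 m) = x - y - (u1 m - u2 m).
  by rewrite !opprB addrACA [RHS]addrACA [X in _ + X = _]addrC.
have -> : x + u1 m - (y + u2 m) = x - y + (u1 m - u2 m).
  by rewrite opprD addrACA.
lra.
Qed.

End Symmetrization.
End Iid.

(** * Exponential deviation bound for finitely many sums *)

Section SeminormDeviation.
Variables (R : realType) (J K : finType) (q : K -> R) (z : K -> J -> R).
Hypothesis q0 : forall k, 0 <= q k.
Hypothesis q1 : \sum_k q k = 1.

Definition maxnorm (v : J -> R) : R := \big[Num.max/0]_j `|v j|.

Lemma maxnorm_ge v j : `|v j| <= maxnorm v.
Proof. exact: le_bigmax. Qed.

Lemma maxnorm_le v b : 0 <= b -> (forall j, `|v j| <= b) -> maxnorm v <= b.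
Proof. by move=> b0 vb; apply: bigmax_le. Qed.

Lemma maxnorm_ge0 v : 0 <= maxnorm v.
Proof. exact: bigmax_ge_id. Qed.

Let mean : J -> R := fun j => \sum_k q k * z k j.

(** The exponential lies above its tangent line at the mean [m]. *)
Lemma expR_jensen (a : K -> R) : expR (\sum_k q k * a k) <= \sum_k q k * expR (a k).
Proof.
set m := \sum_k q k * a k.
apply: (@le_trans _ _ (\sum_k q k * (expR m * (1 + (a k - m))))); last first.
  apply: ler_sum => k _; rewrite ler_wpM2l//.
  by rewrite -[in leRHS](subrKC m (a k)) expRD ler_wpM2l ?expR_ge0// expR_ge1Dx.
under eq_bigr do rewrite mulrCA.
rewrite -mulr_sumr ler_peMr ?expR_ge0//.
under eq_bigr do rewrite mulrDr mulr1 mulrBr.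
by rewrite big_split sumrB -mulr_suml /= q1 mul1r subrr addr0.
Qed.

(** Markov's inequality for the exponential of the norm, followed by symmetrization. *)
Lemma deviation m (lam b t : R) : 0 <= lam ->
  (forall k : nat -> K,
     rade m (fun i => z (k i)) (fun v => expR (2 * lam * maxnorm v)) 0 <= b) ->
  \sum_(f : {ffun 'I_m -> K} | t < maxnorm (\sum_i (z (f i) - mean))) \prod_i q (f i)
    <= b * expR (- (lam * t)).
Proof.
move=> lam0 hb; pose F (v : J -> R) := expR (lam * maxnorm v).
apply: (@le_trans _ _ (iid q (fun k => z k - mean) m F 0 * expR (- (lam * t)))).
  rewrite -iidE mulr_suml big_mkcond; apply: ler_sum => f _.
  have Q0 : 0 <= \prod_i q (f i) by apply: prodr_ge0.
  rewrite add0r -mulrA -expRD; case: ifP => [tN|_]; last by rewrite mulr_ge0 ?expR_ge0.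
  rewrite ler_peMr// -expR0 ler_expR subr_ge0 ler_wpM2l// ltW//.
rewrite ler_wpM2r ?expR_ge0//.
apply: (le_trans (iid_le_centered q0 _ _ _)).
  move=> x; apply: le_trans (expR_jensen _); rewrite ler_expR.
  under eq_bigr do rewrite mulrCA.
  rewrite -mulr_sumr ler_wpM2l//; apply: maxnorm_le => [|j].
    by apply: sumr_ge0 => k _; rewrite mulr_ge0 ?maxnorm_ge0.
  have -> : (x - mean) j = \sum_k q k * (x j - z k j).
    under eq_bigr do rewrite mulrBr.
    by rewrite sumrB -mulr_suml q1 mul1r.
  rewrite (le_trans (ler_norm_sum _ _ _))//; apply: ler_sum => k _.
  by rewrite normrM ger0_norm// ler_wpM2l// (maxnorm_ge (x - z k)).
apply: (iid_sym_le q0 q1) => k.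
(* By [2 x y <= x^2 + y^2] the two samples separate, at the price of doubling [lam]. *)
pose G v := expR (2 * lam * maxnorm v) / 2.
rewrite -(subr0 0); apply: le_trans (@rade_sub_le _ _ _ (fun i => z (k i).1)
   (fun i => z (k i).2) _ G G _ _ _) _.
  move=> v w; rewrite /G /F -mulrDl.
  have h : maxnorm (v - w) <= maxnorm v + maxnorm w.
    apply: maxnorm_le => [|j]; first by rewrite addr_ge0 ?maxnorm_ge0.
    by rewrite (le_trans (ler_normB _ _))// lerD ?maxnorm_ge.
  apply: (@le_trans _ _ (expR (lam * maxnorm v) * expR (lam * maxnorm w))).
    by rewrite -expRD ler_expR -mulrDr ler_wpM2l.
  rewrite -!mulrA !(expRM_natl 2).
  by have := sqr_ge0 (expR (lam * maxnorm v) - expR (lam * maxnorm w)); nra.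
have -> : G = fun v => 2^-1 * expR (2 * lam * maxnorm v).
  by apply/funext => v; rewrite /G mulrC.
rewrite !radeZ; have := hb (fun i => (k i).1); have := hb (fun i => (k i).2); lra.
Qed.

End SeminormDeviation.

Lemma Dnet_deviation (R : realType) p n (B : R) L (J K : finType) (q : K -> R)
    (x : K -> 'rV[R]_p) (h : J -> 'rV[R]_p -> R) (s : R) :
  (0 < n)%N -> 0 < B -> (2 <= L)%N -> 0 <= s ->
  (forall k, 0 <= q k) -> \sum_k q k = 1 -> (forall j, Dnet B L (h j)) ->
  \sum_(f : {ffun 'I_n -> K} |
      [exists j, 2 * (2 ^+ L * (40 * Num.sqrt (p.+1%:R * n%:R))) + s
        < `|\sum_i (h j (x (f i)) - \sum_k q k * h j (x k))|]) \prod_i q (f i)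
    <= expR (- (s ^+ 2 / (32 * n%:R))).
Proof.
move=> n0 B0 L2 s0 q0 q1 hD; set E0 := 2 ^+ L * _.
have nR : 0 < n%:R :> R by rewrite ltr0n.
(* The minimizer of the exponent [8 n lam^2 - lam s], with value [- s^2 / (32 n)]. *)
pose lam := s / (16 * n%:R).
have lam0 : 0 <= lam by rewrite divr_ge0// mulr_ge0.
pose z k : J -> R := fun j => h j (x k).
pose b := expR (2 * lam * E0 + 2 * n%:R * (2 * lam) ^+ 2).
have := @deviation R J K q z q0 q1 n lam b (2 * E0 + s) lam0 _.
have -> : b * expR (- (lam * (2 * E0 + s))) = expR (- (s ^+ 2 / (32 * n%:R))).
  rewrite -expRD; congr expR; rewrite /lam; field.
  by rewrite gt_eqF.
move=> dev; apply: le_trans (dev _).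
- rewrite big_mkcond [leRHS]big_mkcond; apply: ler_sum => f _.
  case: ifP => [/existsP[j hj]|_]; last by case: ifP => // _; exact: prodr_ge0.
  rewrite ifT//; apply: lt_le_trans hj _.
  apply: le_trans (maxnorm_ge _ j); rewrite le_eqVlt; apply/orP; left; apply/eqP.
  by congr `|_|; rewrite fct_sumE.
- move=> k; pose y i := x (k i).
  pose l (e : 'I_n -> R) : J -> R := fun j => pairing (at_sample y (h j)) e.
  have lB : zmod_morphism l by move=> e e'; apply/funext => j; exact: raddfB.
  have l0 : l 0 = 0 by apply/funext => j; exact: raddf0.
  have lb i : (i < n)%N -> l (basis R i) = z (k i).
    by move=> ni; apply/funext => j; exact: (pairing_basis _ (Ordinal ni)).
  rewrite -l0 -(eq_rade _ _ lb) -rade_comp//.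
  have lam2 : 0 <= 2 * lam by rewrite mulr_ge0.
  apply: le_trans (rade_expR_Dnet y n0 B0 L2 lam2).
  apply: rade_le => e; rewrite ler_expR ler_wpM2l//.
  have D1 : le1 (@Dnet R p B L) by move=> f w; exact: Dnet_le1.
  apply: maxnorm_le => [|j]; last exact: sup_abs_ub.
  case: L L2 D1 {E0 b dev hD} => [|[|L]]// _ D1.
  have [f Df] := hull_nonempty (layer_nodes_nonempty p L B0).
  exact: le_trans (sup_abs_ub y e D1 Df).
Qed.

(** * Means of bounded measurable functions *)

Section BoundedMeasurable.
Context (d : measure_display) (T : measurableType d) (R : realType).
Variable Q : probability T R.
Implicit Types (f g : T -> R).

Definition bounded_measurable f :=
  measurable_fun setT f /\ exists M, forall x, `|f x| <= M.

Definition mean f : R := Rintegral Q setT f.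

Lemma bm_integrable f : bounded_measurable f -> Q.-integrable setT (EFin \o f).
Proof.
move=> [mf [M fM]]; apply: measurable_bounded_integrable => //.
  by rewrite (le_lt_trans (probability_le1 _ _))// ltry.
exists M; split; first exact: num_real.
by move=> y My x _; exact: le_trans (fM x) (ltW My).
Qed.

Lemma bmD f g : bounded_measurable f -> bounded_measurable g ->
  bounded_measurable (fun x => f x + g x).
Proof.
move=> [mf [M fM]] [mg [N gN]]; split; first exact: measurable_funD.
by exists (M + N) => x; rewrite (le_trans (ler_normD _ _))// lerD.
Qed.

Lemma bm_cst (a : R) : bounded_measurable (fun=> a).
Proof. by split; [exact: measurable_cst|exists `|a|]. Qed.

Lemma bmZ (a : R) f : bounded_measurable f -> bounded_measurable (fun x => a * f x).
Proof.
move=> [mf [M fM]]; split.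
  by apply: measurable_funM => //; exact: measurable_cst.
by exists (`|a| * M) => x; rewrite normrM ler_wpM2l.
Qed.

Lemma bmB f g : bounded_measurable f -> bounded_measurable g ->
  bounded_measurable (fun x => f x - g x).
Proof.
move=> bf bg; have := bmD bf (bmZ (-1) bg).
by rewrite (_ : (fun x => _) = fun x => f x - g x)//; apply/funext => x; rewrite mulN1r.
Qed.

Lemma bm_indic (A : set T) : measurable A -> bounded_measurable (\1_A).
Proof.
move=> mA; split; first exact: measurable_indic.
by exists 1 => x; rewrite indicE; case: (_ \in _); rewrite ?normr0 ?normr1.
Qed.

Lemma bm_sum (I : Type) (r : seq I) (F : I -> T -> R) :
  (forall i, bounded_measurable (F i)) ->
  bounded_measurable (fun x => \sum_(i <- r) F i x).
Proof.
move=> bF; elim: r => [|i r IH].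
  rewrite (_ : (fun x => _) = fun=> 0); first exact: bm_cst.
  by apply/funext => x; rewrite big_nil.
rewrite (_ : (fun x => _) = fun x => F i x + \sum_(i <- r) F i x); first exact: bmD.
by apply/funext => x; rewrite big_cons.
Qed.

Lemma meanE f : bounded_measurable f -> (\int[Q]_x (f x)%:E)%E = (mean f)%:E.
Proof. by move=> /bm_integrable/integrable_fin_num-/(_ measurableT)/fineK. Qed.

Lemma mean_cst (a : R) : mean (fun=> a) = a.
Proof. by rewrite /mean Rintegral_cst//= (_ : _ setT = 1%E) ?mulr1//; exact: (probability_setT Q). Qed.

Lemma meanD f g : bounded_measurable f -> bounded_measurable g ->
  mean (fun x => f x + g x) = mean f + mean g.
Proof. by move=> bf bg; rewrite /mean RintegralD//; exact: bm_integrable. Qed.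

Lemma meanB f g : bounded_measurable f -> bounded_measurable g ->
  mean (fun x => f x - g x) = mean f - mean g.
Proof. by move=> bf bg; rewrite /mean RintegralB//; exact: bm_integrable. Qed.

Lemma meanZ (a : R) f : bounded_measurable f -> mean (fun x => a * f x) = a * mean f.
Proof. by move=> bf; rewrite /mean RintegralZl//; exact: bm_integrable. Qed.

Lemma mean_sum (I : Type) (r : seq I) (F : I -> T -> R) :
  (forall i, bounded_measurable (F i)) ->
  mean (fun x => \sum_(i <- r) F i x) = \sum_(i <- r) mean (F i).
Proof.
move=> bF; elim: r => [|i r IH].
  rewrite big_nil -[RHS]mean_cst; congr mean.
  by apply/funext => x; rewrite big_nil.
rewrite big_cons -IH -meanD//; last exact: bm_sum.
by congr mean; apply/funext => x; rewrite big_cons.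
Qed.

Lemma mean_le f g : bounded_measurable f -> bounded_measurable g ->
  (forall x, f x <= g x) -> mean f <= mean g.
Proof. by move=> bf bg fg; apply: le_Rintegral => //; exact: bm_integrable. Qed.

Lemma mean_dist f g (eta : R) : bounded_measurable f -> bounded_measurable g ->
  (forall x, `|f x - g x| <= eta) -> `|mean f - mean g| <= eta.
Proof.
move=> bf bg fg; have bfg := bmB bf bg; rewrite -meanB// ler_norml.
apply/andP; split.
- rewrite -(mean_cst (- eta)); apply: mean_le bfg _; first exact: bm_cst.
  by move=> x; have := fg x; rewrite ler_norml => /andP[].
- rewrite -[leRHS](mean_cst eta); apply: mean_le bfg _ _; first exact: bm_cst.
  by move=> x; have := fg x; rewrite ler_norml => /andP[].
Qed.

Lemma mean_indic (A : set T) : measurable A -> mean \1_A = fine (Q A).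
Proof. by move=> mA; rewrite /mean /Rintegral integral_indic// setIT. Qed.

Lemma mean_finite (K : finType) (kap : T -> K) (g : K -> R) :
  (forall k, measurable (kap @^-1` [set k])) ->
  bounded_measurable (g \o kap) /\
  mean (g \o kap) = \sum_k fine (Q (kap @^-1` [set k])) * g k.
Proof.
move=> mk.
have e : g \o kap = fun x => \sum_k g k * \1_(kap @^-1` [set k]) x.
  apply/funext => x /=; rewrite (bigD1 (kap x))//= big1 ?addr0.
    by rewrite indicE mem_set ?mulr1.
  by move=> k kx; rewrite indicE memNset ?mulr0//= => e; rewrite e eqxx in kx.
have b k : bounded_measurable (fun x => g k * \1_(kap @^-1` [set k]) x).
  exact/bmZ/bm_indic.
split; first by rewrite e; exact: bm_sum.
rewrite e mean_sum//; apply: eq_bigr => k _; rewrite meanZ ?mean_indic// 1?mulrC//.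
exact: bm_indic.
Qed.

Lemma sum_cells (K : finType) (kap : T -> K) :
  (forall k, measurable (kap @^-1` [set k])) ->
  \sum_k fine (Q (kap @^-1` [set k])) = 1.
Proof.
move=> mk; have [_] := mean_finite (fun=> 1) mk.
rewrite mean_cst => ->; by apply: eq_bigr => k _; rewrite mulr1.
Qed.

Lemma mean_cvg (f_ : nat -> T -> R) f (M : R) :
  (forall n, measurable_fun setT (f_ n)) -> (forall n x, `|f_ n x| <= M) ->
  bounded_measurable f -> (forall x, f_ ^~ x @ \oo --> f x) ->
  mean (f_ n) @[n --> \oo] --> mean f.
Proof.
move=> mf fM bf cf.
have [|||||_ _ cv] := @dominated_convergence _ _ _ Q setT measurableT
   (fun n => EFin \o f_ n) (EFin \o f) (cst M%:E).
- by move=> n; apply/measurable_EFinP.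
- by apply/measurable_EFinP; have [] := bf.
- by apply: aeW => x _ /=; apply: cvg_EFin; [exact: nearW|exact: cf].
- by apply: (@bm_integrable (fun=> M)); exact: bm_cst.
- by apply: aeW => x n _ /=; rewrite lee_fin.
move: cv; have -> : (fun n => \int[Q]_x (EFin \o f_ n) x)%E = EFin \o (fun n => mean (f_ n)).
  by apply/funext => n /=; rewrite -meanE//; split => //; exists M.
rewrite (_ : (\int[Q]_x (EFin \o f) x)%E = (mean f)%:E); last by rewrite -meanE.
by move/fine_cvgP => [].
Qed.

End BoundedMeasurable.

(** A cell is a tuple of values rounded down to a grid of mesh [1 / N], so two points of one cell
    have values within [1 / N]. *)
Lemma discretize (d : measure_display) (T : measurableType d) (R : realType)
    (J : finType) (h : J -> T -> R) (eta : R) : 0 < eta ->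
  (forall j, measurable_fun setT (h j)) -> (forall j x, `|h j x| <= 1) ->
  exists (K : finType) (kap : T -> K) (x : K -> T),
    (forall k, measurable (kap @^-1` [set k])) /\
    forall j t, `|h j t - h j (x (kap t))| <= eta.
Proof.
move=> eta0 mh h1.
pose N := (Num.truncn (1 / eta)).+1; have N0 : 0 < N%:R :> R by rewrite ltr0n.
have Neta : N%:R^-1 <= eta.
  by rewrite invf_ple ?posrE//; apply/ltW; rewrite -div1r truncnS_gt.
(* The shift by 1 makes the values nonnegative, so that [truncn] rounds down and takes at most
   [2 N + 1] values. *)
pose v j t : R := (h j t + 1) * N%:R.
have v0 j t : 0 <= v j t.
  by rewrite mulr_ge0 ?(ltW N0)//; have := h1 j t; rewrite ler_norml => /andP[]; lra.
have v2 j t : (Num.truncn (v j t) < (2 * N).+1)%N.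
  rewrite ltnS truncn_le_nat -natr1 natrM; apply: (@le_lt_trans _ _ (2 * N%:R)); last by lra.
  by rewrite ler_wpM2r ?(ltW N0)//; have := h1 j t; rewrite ler_norml => /andP[]; lra.
pose K : finType := {ffun J -> 'I_(2 * N).+1}.
pose kap t : K := [ffun j => Ordinal (v2 j t)].
have [x xP] : exists x : K -> T, forall t, kap (x (kap t)) = kap t.
  have /choice[x xP] : forall k, exists x, (exists t, kap t = k) -> kap x = k.
    move=> k; case: (pselect (exists t, kap t = k)) => [[t tk]|nk]; first by exists t.
    (* Reached only for empty cells. *)
    by exists point.
  by exists x => t; apply: xP; exists t.
exists K, kap, x; split=> [k|j t].
- have -> : kap @^-1` [set k] = \bigcap_(j in [set: J])
      (h j @^-1` `[(k j)%:R / N%:R - 1, (k j).+1%:R / N%:R - 1[).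
    have key j t : (Num.truncn (v j t) = k j :> nat) <->
        `[(k j)%:R / N%:R - 1, (k j).+1%:R / N%:R - 1[%classic (h j t).
      rewrite /= in_itv /= lerBlDr ltrBrDr ler_pdivrMr// ltr_pdivlMr//.
      by rewrite -/(v j t) -(truncn_eq _ (v0 j t)); split => [->|/eqP].
    apply/seteqP; split => [t /= kt j _|t kt].
      by apply/key; rewrite -kt ffunE.
    by apply/ffunP => j; apply/val_inj; rewrite ffunE /=; apply/key; exact: kt.
  apply: fin_bigcap_measurable; first exact: finite_finset.
  move=> j _; rewrite -[X in measurable X]setTI; apply: mh => //.
- have /ffunP/(_ j) := xP t; rewrite !ffunE => /(congr1 val) /= e.
  apply: le_trans Neta.
  have /truncn_itv := v0 j t; have /truncn_itv := v0 j (x (kap t)).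
  rewrite e -natr1 /v => /andP[a1 a2] /andP[b1 b2].
  rewrite -(ler_pM2r N0) mulVf ?gt_eqF// -{1}(ger0_norm (ltW N0)) -normrM ler_norml.
  by apply/andP; split; lra.
Qed.

(** * Measurability of networks *)

Section Measurability.
Variables (R : realType) (p : nat).

Lemma measurable_coord (i : 'I_p) :
  measurable_fun setT (fun x : Rp R p => (x : 'rV[R]_p) ord0 i).
Proof.
apply: (measurability _ (RGenOpens.measurableE R)).
move=> _ [_ [a [b ->]] <-]; rewrite setTI; apply: sub_sigma_algebra.
apply: open_comp; last exact: interval_open.
by move=> x _; exact: coord_continuous.
Qed.

Lemma measurable_dotp (w : 'rV[R]_p) : measurable_fun setT (dotp w : Rp R p -> R).
Proof.
apply: measurable_sum => i; apply: measurable_funM; first exact: measurable_cst.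
exact: measurable_coord.
Qed.

(** Pairs carry the product sigma-algebra, which is not by definition generated by open sets, so the
    argument goes through coordinates. *)
Lemma measurable_norm2B :
  measurable_fun setT (fun z : Rp R p * Rp R p => norm2 (z.1 - z.2 : 'rV[R]_p)).
Proof.
apply: (@measurableT_comp _ _ _ _ _ _ (@Num.sqrt R)).
  by apply: continuous_measurable_fun; exact: sqrt_continuous.
apply: measurable_sum => i; apply: measurable_funX.
rewrite (_ : (fun z => _) = fun z : Rp R p * Rp R p =>
   (z.1 : 'rV[R]_p) ord0 i - (z.2 : 'rV[R]_p) ord0 i); last first.
  by apply/funext => z; rewrite !mxE.
apply: measurable_funB.
- exact: (measurableT_comp (measurable_coord i) measurable_fst).
- exact: (measurableT_comp (measurable_coord i) measurable_snd).
Qed.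

Lemma measurable_hull (T : set ('rV[R]_p -> R)) f :
  (forall g, T g -> measurable_fun setT (g : Rp R p -> R)) ->
  hull T f -> measurable_fun setT (f : Rp R p -> R).
Proof.
move=> mT [d [w [g [_ [gT [_ ->]]]]]].
apply: measurable_sum => i; apply: measurable_funM; first exact: measurable_cst.
exact: mT.
Qed.

Lemma measurable_layer_nodes B l f : @layer_nodes R p B l f ->
  measurable_fun setT (f : Rp R p -> R).
Proof.
case: l => // l; elim: l f => [|l IH] f.
  move=> [w [b [_ ->]]]; apply: (@measurableT_comp _ _ _ _ _ _ (@sigmoid R)).
    apply: continuous_measurable_fun => x; apply: differentiable_continuous.
    by apply/derivable1_diffP; have [] := is_derive_sigmoid x.
  by apply: measurable_funD; [exact: measurable_dotp|exact: measurable_cst].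
move=> /layer_nodesSS[h Hh ->].
apply: (@measurable_maxr _ (Rp R p) R setT h (cst 0)); last exact: measurable_cst.
exact: measurable_hull Hh.
Qed.

Lemma Dnet_bounded_measurable B L f : Dnet B L f ->
  bounded_measurable (f : Rp R p -> R).
Proof.
move=> Df; split; last by exists 1 => x; exact: Dnet_le1 Df.
by apply: measurable_hull Df => g; exact: measurable_layer_nodes.
Qed.

End Measurability.

(** * Wasserstein distance and Lipschitz functions *)

Section Wasserstein.
Variables (R : realType) (p : nat) (P Q : probability (Rp R p) R).

Lemma mean_marginal (Pi : probability (Rp R p * Rp R p)%type R)
    (m : probability (Rp R p) R) (phi : Rp R p * Rp R p -> Rp R p) (f : Rp R p -> R) :
  measurable_fun setT phi ->
  (forall A, measurable A -> Pi (phi @^-1` A) = m A) ->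
  bounded_measurable f ->
  bounded_measurable (f \o phi) /\ mean Pi (f \o phi) = mean m f.
Proof.
move=> mphi marg bf; have [mf [M fM]] := bf.
have bphi : bounded_measurable (f \o phi).
  by split; [exact: measurableT_comp|exists M => z; exact: fM].
split => //; apply: EFin_inj; rewrite -!meanE//.
rewrite -(@eq_measure_integral _ _ _ setT m (pushforward Pi phi)).
  rewrite integral_pushforward//; first exact/measurable_EFinP.
  exact: bm_integrable bphi.
by move=> A mA _; exact: (marg A mA).
Qed.

(** The easy half of Kantorovich duality. The infimum is not assumed attained, so a coupling of cost
    below [eps + e] is used, with [e] arbitrary. *)
Lemma W1_mean (c eps : R) (f : Rp R p -> R) : 0 <= c ->
  (W1 P Q <= eps%:E)%E -> bounded_measurable f ->
  (forall x y : 'rV[R]_p, `|f x - f y| <= c * norm2 (x - y)) ->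
  `|mean P f - mean Q f| <= c * eps.
Proof.
move=> c0 W bf lip.
suff h e : 0 < e -> `|mean P f - mean Q f| <= c * (eps + e).
  apply/ler_addgt0Pr => e e0; have ce : 0 < e / (c + 1) by rewrite divr_gt0//; lra.
  apply: le_trans (h _ ce) _; rewrite mulrDr lerD2l mulrA ler_pdivrMr; last by lra.
  by rewrite mulrDr mulr1 [e * c]mulrC lerDl ltW.
move=> e0; have : (W1 P Q < (eps + e)%:E)%E.
  by apply: le_lt_trans W _; rewrite lte_fin ltrDl.
move=> /ereal_inf_lt[_ [Pi [marg1 marg2] <-] lt_eps].
have [b1 <-] := mean_marginal measurable_fst marg1 bf.
have [b2 <-] := mean_marginal measurable_snd marg2 bf.
rewrite -meanB// -lee_fin -abse_EFin.
have b12 := bmB b1 b2.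
rewrite -[X in `|X|%E]meanE//.
have mN := @measurable_norm2B R p.
apply: (le_trans (le_abse_integral _ _ _)) => //.
  by apply/measurable_EFinP; have [] := b12.
apply: (@le_trans _ _ (\int[Pi]_z (c%:E * (norm2 (z.1 - z.2 : 'rV[R]_p))%:E))%E).
  apply: ge0_le_integral => //.
  - apply: measurableT_comp => //; apply/measurable_EFinP.
    by have [] := b12.
  - by apply/measurable_EFinP; apply: measurable_funM => //; exact: measurable_cst.
  - by move=> z _; rewrite /= lee_fin; exact: lip.
rewrite ge0_integralZl_EFin//; last 2 first.
- by move=> z _; rewrite lee_fin norm2_ge0.
- exact/measurable_EFinP.
by rewrite EFinM lee_wpmul2l ?lee_fin// ltW.
Qed.

End Wasserstein.

(* [h] enumerates functions of [D] chosen to realize, for each [N] and each list of integers, the values [floor (N * f)] at the first [N] rational points. *)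
Lemma countable_approx (R : realType) p (D : set ('rV[R]_p -> R)) (c : R) :
  D !=set0 -> 0 <= c ->
  (forall f x y, D f -> `|f x - f y| <= c * norm2 (x - y)) ->
  exists h : nat -> 'rV[R]_p -> R, (forall m, D (h m)) /\
    forall f, D f -> exists m : nat -> nat,
      forall x, h (m N) x @[N --> \oo] --> f x.
Proof.
move=> [f0 Df0] c0 lip.
pose pt i : 'rV[R]_p := map_mx ratr (odflt (0 : 'rV[rat]_p) (unpickle i)).
have ptD x eps : 0 < eps -> exists i, norm2 (x - pt i) <= eps.
  move=> e0; pose e := eps / p.+1%:R.
  have e1 : 0 < e by rewrite divr_gt0.
  have /choice[r rP] : forall i : 'I_p, exists r : rat, `|x ord0 i - ratr r| <= e.
    move=> i; have lt : x ord0 i - e < x ord0 i + e by lra.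
    have [r] := rat_in_itvoo lt; rewrite in_itv /= => /andP[r1 r2].
    by exists r; rewrite ler_norml; apply/andP; split; lra.
  exists (pickle (\row_i r i : 'rV[rat]_p)); rewrite /pt pickleK /=.
  have -> : eps = p.+1%:R * e by rewrite mulrC divfK.
  rewrite -(@ler_pXn2r _ 2)// ?nnegrE ?norm2_ge0 ?mulr_ge0 ?(ltW e1) ?(ltW e0)//.
  rewrite norm2_sqr; apply: (@le_trans _ _ (\sum_(i < p) e ^+ 2)).
    apply: ler_sum => i _; rewrite !mxE -(real_normK (num_real (_ - _))).
    by rewrite lerXn2r ?nnegrE ?(ltW e1).
  rewrite sumr_const card_ord -[leLHS]mulr_natl [leRHS]exprMn ler_wpM2r ?sqr_ge0//.
  by rewrite -natrX ler_nat; nia.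
pose pat (N : nat) (f : 'rV[R]_p -> R) := [seq Num.floor (N%:R * f (pt i)) | i <- iota 0 N].
have /choice[g gP] : forall s : nat * seq int, exists g, D g /\
    forall f, D f -> pat s.1 f = s.2 -> pat s.1 g = s.2.
  move=> [N s]; case: (pselect (exists2 f, D f & pat N f = s)) => [[f Df fs]|nf].
    by exists f.
  by exists f0; split => // f Df fs; case: nf; exists f.
pose code m : nat * seq int := odflt (0%N, [::]) (unpickle m).
exists (fun m => g (code m)); split; first by move=> m; have [] := gP (code m).
move=> f Df; exists (fun N => pickle (N, pat N f)) => x.
apply/cvgrPdist_le => eps e0.
have e1 : 0 < eps / (3 * (c + 1)) by rewrite divr_gt0// mulr_gt0//; lra.
have [i xi] := ptD x _ e1.
have cxi : c * norm2 (x - pt i) <= eps / 3.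
  apply: (@le_trans _ _ (c * (eps / (3 * (c + 1))))); first exact: ler_wpM2l.
  have -> : eps / (3 * (c + 1)) = eps / 3 / (c + 1) by rewrite invfM mulrA.
  rewrite mulrA ler_pdivrMr; last by lra.
  by rewrite mulrC mulrDr mulr1 lerDl divr_ge0// ltW.
(* [N > i] puts [pt i] into the pattern; [N >= 3 / eps] makes values with equal floors differ by at
   most [eps / 3]. *)
exists (maxn i.+1 (Num.truncn (3 / eps)).+1) => // N /=; rewrite geq_max => /andP[iN eN].
rewrite /code pickleK /=; have [Dg /(_ f Df erefl)] := gP (N, pat N f).
set u := g _ in Dg *; move=> /= puf.
have N0 : 0 < N%:R :> R by rewrite ltr0n (leq_trans _ iN).
have Neps : 3 / eps <= N%:R.
  by apply: le_trans (ltW (truncnS_gt _)) _; rewrite ler_nat.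
have fu : `|f (pt i) - u (pt i)| <= eps / 3.
  have : Num.floor (N%:R * u (pt i)) = Num.floor (N%:R * f (pt i)).
    have := congr1 (fun s => nth 0 s i) puf.
    by rewrite !(nth_map 0%N) ?size_iota// !nth_iota.
  have := floor_itv (N%:R * u (pt i)); have := floor_itv (N%:R * f (pt i)).
  move=> F U E; move: F U; rewrite E intrD => /andP[a1 a2] /andP[b1 b2].
  have N1 : 1 <= N%:R * (eps / 3).
    by move: Neps; rewrite ler_pdivrMr// mulrA ler_pdivlMr// mul1r.
  rewrite -(ler_pM2l N0) -{1}(ger0_norm (ltW N0)) -normrM mulrBr ler_norml.
  by apply/andP; split; lra.
have l1 := lip f x (pt i) Df; have l2 := lip u x (pt i) Dg.
have -> : f x - u x = (f x - f (pt i)) + (f (pt i) - u (pt i)) - (u x - u (pt i)).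
  by ring.
rewrite (le_trans (ler_normB _ _))//.
by have := ler_normD (f x - f (pt i)) (f (pt i) - u (pt i)); lra.
Qed.

(** * Uniform deviations and the estimator *)

Lemma probability_bigsetU_le (d : measure_display) (T : measurableType d)
    (R : realType) (Pr : probability T R) (I : finType) (Q : pred I) (F : I -> set T) :
  (forall i, measurable (F i)) ->
  (Pr (\big[setU/set0]_(i | Q i) F i) <= \sum_(i | Q i) Pr (F i))%E.
Proof.
move=> mF; elim: (index_enum I) => [|i r IH]; first by rewrite !big_nil measure0.
rewrite !big_cons; case: ifP => // _.
apply: le_trans (measureU2 _ _ _) _ => //; first exact: bigsetU_measurable.
exact: leeD2l.
Qed.

Lemma cvg_sum_fun (R : realType) (I : Type) (r : seq I) (F : I -> nat -> R) (l : I -> R) :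
  (forall i, F i N @[N --> \oo] --> l i) ->
  \sum_(i <- r) F i N @[N --> \oo] --> \sum_(i <- r) l i.
Proof.
move=> Fl; elim: r => [|i r IH].
  rewrite big_nil (_ : (fun N => _) = cst 0); first exact: cvg_cst.
  by apply/funext => N; rewrite big_nil.
rewrite big_cons (_ : (fun N => _) = fun N => F i N + \sum_(i <- r) F i N).
  exact: cvgD.
by apply/funext => N; rewrite big_cons.
Qed.

Section Deviation.
Variables (R : realType) (d : measure_display) (Omega : measurableType d).
Variables (Pr : probability Omega R) (p n : nat) (X : 'I_n -> Omega -> Rp R p).
Variables (P : probability (Rp R p) R).
Hypothesis iidX : iid_sample Pr X P.

(** The event depends on the cells only, so it is a finite union of rectangles; an upper bound
    suffices, so subadditivity is enough. *)
Lemma iid_cells (K : finType) (kap : Rp R p -> K) (Bad : pred {ffun 'I_n -> K}) :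
  (forall k, measurable (kap @^-1` [set k])) ->
  let cell w := [ffun i => kap (X i w)] in
  measurable [set w | Bad (cell w)] /\
  (Pr [set w | Bad (cell w)]
    <= (\sum_(f | Bad f) \prod_i fine (P (kap @^-1` [set f i])))%:E)%E.
Proof.
move=> mk cell; have [mX [lawX indX]] := iidX.
pose C (f : {ffun 'I_n -> K}) := \bigcap_i (X i @^-1` (kap @^-1` [set f i])).
have mC f : measurable (C f).
  apply: fin_bigcap_measurable; first exact: finite_finset.
  by move=> i _; rewrite -[X in measurable X]setTI; apply: mX.
have -> : [set w | Bad (cell w)] = \big[setU/set0]_(f in Bad) C f.
  rewrite -bigcup_pred; apply/seteqP; split => [w Bw|w [f /= Bf Cw]].
    by exists (cell w) => // i _; rewrite /= ffunE.
  rewrite (_ : cell w = f)//.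
  by apply/ffunP => i; rewrite ffunE; exact: (Cw i I).
split; first by apply: bigsetU_measurable => f _.
apply: le_trans (probability_bigsetU_le _ _ mC) _.
rewrite -sumEFin; apply: lee_sum => f _.
rewrite indX; last by move=> i.
rewrite -prodEFin le_eqVlt; apply/orP; left; apply/eqP.
by apply: eq_bigr => i _; rewrite lawX// fineK// fin_num_measure.
Qed.

(** Quantization moves the sum and [n] times the mean by at most [n * eta] each, hence the term
    [2 * n%:R * eta]. *)
Lemma finite_class_deviation (B : R) L (J : finType) (h : J -> 'rV[R]_p -> R) (s eta : R) :
  (0 < n)%N -> 0 < B -> (2 <= L)%N -> 0 <= s -> 0 < eta ->
  (forall j, Dnet B L (h j)) ->
  let t := 2 * (2 ^+ L * (40 * Num.sqrt (p.+1%:R * n%:R))) + s + 2 * n%:R * eta in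
  let bad := [set w | exists j, t < `|\sum_i h j (X i w) - n%:R * mean P (h j)|] in
  measurable bad /\ (Pr bad <= (expR (- (s ^+ 2 / (32 * n%:R))))%:E)%E.
Proof.
move=> n0 B0 L2 s0 eta0 hD t bad; have [mX _] := iidX.
have bh j : bounded_measurable (h j : Rp R p -> R) by exact: Dnet_bounded_measurable (hD j).
have nR : 0 < n%:R :> R by rewrite ltr0n.
have mbad : measurable bad.
  have -> : bad = \bigcup_(j in [set: J])
      ((fun w => `|\sum_i h j (X i w) - n%:R * mean P (h j)|) @^-1` `]t, +oo[).
    apply/seteqP; split => [w [j tj]|w [j _]].
      by exists j => //=; rewrite in_itv /= tj.
    by rewrite /= in_itv /= andbT => tj; exists j.
  apply: fin_bigcup_measurable; first exact: finite_finset.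
  move=> j _; rewrite -[X in measurable X]setTI.
  have mf : measurable_fun setT (fun w => `|\sum_i h j (X i w) - n%:R * mean P (h j)|).
    apply: (@measurableT_comp _ _ _ _ _ _ (@Num.norm R R)); first exact: normr_measurable.
    apply: measurable_funB; last exact: measurable_cst.
    by apply: measurable_sum => i; apply: (measurableT_comp (proj1 (bh j))).
  exact: mf.
split => //.
have [K [kap [x [mk kapP]]]] := discretize eta0 (fun j => proj1 (bh j))
  (fun j y => Dnet_le1 y (hD j)).
pose q k := fine (P (kap @^-1` [set k])).
have q0 k : 0 <= q k by exact: fine_ge0.
have q1 : \sum_k q k = 1 by exact: sum_cells.
have dev := @Dnet_deviation R p n B L J K q x h s n0 B0 L2 s0 q0 q1 hD.
pose Bad (f : {ffun 'I_n -> K}) := [exists j,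
  2 * (2 ^+ L * (40 * Num.sqrt (p.+1%:R * n%:R))) + s
        < `|\sum_i (h j (x (f i)) - \sum_k q k * h j (x k))|].
have [mB PB] := iid_cells Bad mk.
apply: (@le_trans _ _ (Pr [set w | Bad [ffun i => kap (X i w)]])); last first.
  by apply: le_trans PB _; rewrite lee_fin.
apply: le_measure; rewrite ?inE// => w [j tj]; apply/existsP; exists j.
have [bg gE] := mean_finite P (fun k => h j (x k)) mk.
have m1 : `|mean P (h j) - \sum_k q k * h j (x k)| <= eta.
  by rewrite -gE; apply: mean_dist => // y; exact: kapP.
have m2 : `|\sum_i h j (X i w) - \sum_i h j (x (kap (X i w)))| <= n%:R * eta.
  rewrite -sumrB (le_trans (ler_norm_sum _ _ _))//.
  rewrite (_ : n%:R * eta = \sum_(i < n) eta); last by rewrite sumr_const card_ord mulr_natl.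
  by apply: ler_sum => i _; exact: kapP.
have m3 : `|n%:R * mean P (h j) - n%:R * \sum_k q k * h j (x k)| <= n%:R * eta.
  by rewrite -mulrBr normrM ger0_norm ?(ltW nR)// ler_pM2l.
rewrite sumrB sumr_const card_ord -[X in _ - X]mulr_natl.
under eq_bigr do rewrite ffunE.
move: tj m2 m3; rewrite /t; set a := \sum_i h j (X i w); set b := \sum_i h j (x _).
set u := n%:R * mean _ _; set v := n%:R * (\sum_k _).
have := ler_distD b a u; have := ler_distD v b u; rewrite [`|v - u|]distrC.
lra.
Qed.


Lemma Dnet_nonempty (B : R) L : 0 < B -> (2 <= L)%N -> @Dnet R p B L !=set0.
Proof.
move=> B0; case: L => [|[|L]]// _.
exact: hull_nonempty (layer_nodes_nonempty p L B0).
Qed.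

(** The bad events of the first [N + 1] functions of the dense sequence increase with [N] and share
    one bound, which their union inherits by continuity from below. Off the union, the inequality is
    closed and passes to pointwise limits. *)
Lemma Dnet_sum_deviation (B : R) L (s eta : R) :
  (0 < n)%N -> 0 < B -> (2 <= L)%N -> 0 <= s -> 0 < eta ->
  let t := 2 * (2 ^+ L * (40 * Num.sqrt (p.+1%:R * n%:R))) + s + 2 * n%:R * eta in
  exists A, measurable A /\
    ((1 - expR (- (s ^+ 2 / (32 * n%:R))))%:E <= Pr A)%E /\
    forall w, A w -> forall f, Dnet B L f ->
      `|\sum_i f (X i w) - n%:R * mean P f| <= t.
Proof.
move=> n0 B0 L2 s0 eta0 t; set dl := expR _.
have [h [hD happ]] := countable_approx (Dnet_nonempty B0 L2)
  (divr_ge0 (ltW B0) (ler0n _ 4)) (fun f x y => @Dnet_lip R p B L f x y (ltW B0)).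
pose bad N := [set w | exists j : 'I_N.+1,
  t < `|\sum_i h j (X i w) - n%:R * mean P (h j)|].
have badP N : measurable (bad N) /\ (Pr (bad N) <= dl%:E)%E.
  exact: (@finite_class_deviation B L 'I_N.+1 (fun j => h j) s eta).
have mbad : measurable (\bigcup_N bad N).
  by apply: bigcup_measurable => N _; have [] := badP N.
have Pbad : (Pr (\bigcup_N bad N) <= dl%:E)%E.
  have cv : Pr (bad N) @[N --> \oo] --> Pr (\bigcup_N bad N).
    apply: nondecreasing_cvg_mu => // [N|N M NM]; first by have [] := badP N.
    apply/subsetPset => w [j tj].
    by exists (widen_ord (NM : (N.+1 <= M.+1)%N) j).
  rewrite -(cvg_lim (@ereal_hausdorff R) cv); apply: lime_le; first exact: cvgP cv.
  by apply: nearW => N; have [] := badP N.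
exists (~` \bigcup_N bad N); split; first exact: measurableC.
split; first by rewrite probability_setC// EFinB leeB.
move=> w Aw f Df; have [m mf] := happ f Df.
have bh k : bounded_measurable (h k : Rp R p -> R) by exact: Dnet_bounded_measurable (hD k).
have cm : mean P (h (m N)) @[N --> \oo] --> mean P f.
  apply: (@mean_cvg _ _ _ P (fun N => h (m N)) f 1).
  - by move=> N; have [] := bh (m N).
  - by move=> N x; exact: Dnet_le1 (hD _).
  - exact: Dnet_bounded_measurable Df.
  - exact: mf.
have cs : (\sum_i h (m N) (X i w)) @[N --> \oo] --> \sum_i f (X i w).
  by apply: cvg_sum_fun => i; exact: mf.
have cn : `|\sum_i h (m N) (X i w) - n%:R * mean P (h (m N))| @[N --> \oo] -->
    `|\sum_i f (X i w) - n%:R * mean P f|.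
  by apply: cvg_norm; apply: cvgB => //; apply: cvgMr.
rewrite -(cvg_lim (@Rhausdorff R) cn); apply: limr_le; first exact: cvgP cn.
apply: nearW => N; rewrite leNgt; apply/negP => tN; apply: Aw.
by exists (m N) => //; exists ord_max.
Qed.

(* [s = 4 n sqrt (2 ln (1 / delta) / n)] solves [s ^ 2 / (32 n) = ln (1 / delta)]; as [s > 0], it also pays for the discretization error [2 n eta]. *)
Lemma Dnet_deviation_le (B : R) L (delta : R) :
  (0 < p)%N -> (0 < n)%N -> 0 < B -> (2 <= L)%N -> 0 < delta < 1 ->
  exists A, measurable A /\ ((1 - delta)%:E <= Pr A)%E /\
    forall w, A w -> forall f, Dnet B L f ->
      `|emp_mean (fun i => X i w) f - mean P f| <=
      160 * (2 ^+ L * Num.sqrt (p%:R / n%:R) + Num.sqrt (2 * ln (1 / delta) / n%:R)).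
Proof.
move=> p0 n0 B0 L2 /andP[d0 d1].
have nR : 0 < n%:R :> R by rewrite ltr0n.
have pR : 1 <= p%:R :> R by rewrite ler1n.
set a := Num.sqrt (p%:R / n%:R); set b := Num.sqrt _.
have ln0 : 0 < ln (1 / delta) by rewrite ln_gt0// div1r invf_gt1.
have b0 : 0 < b by rewrite sqrtr_gt0 divr_gt0// mulr_gt0.
have b2 : b ^+ 2 = 2 * ln (1 / delta) / n%:R.
  by rewrite sqr_sqrtr// divr_ge0// ltW// mulr_gt0.
have a0 : 0 <= a by exact: sqrtr_ge0.
(* Here [p >= 1] enters, through [p + 1 <= 4 p]. *)
have pa : Num.sqrt (p.+1%:R * n%:R) <= 2 * n%:R * a.
  rewrite -(@ler_pXn2r _ 2)// ?nnegrE ?sqrtr_ge0 ?mulr_ge0// exprMn.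
  rewrite !sqr_sqrtr ?mulr_ge0 ?divr_ge0// exprMn -natr1.
  have -> : 2 ^+ 2 * n%:R ^+ 2 * (p%:R / n%:R) = 4 * p%:R * n%:R :> R.
    by field; rewrite gt_eqF.
  by rewrite ler_pM2r//; lra.
pose s := 4 * n%:R * b.
have s0 : 0 <= s by rewrite !mulr_ge0// ltW.
(* With mesh [2 * b] the error [2 n eta] equals [s]. *)
have eta0 : 0 < 2 * b by rewrite mulr_gt0.
have [A [mA [PA Adev]]] := Dnet_sum_deviation n0 B0 L2 s0 eta0.
have sd : expR (- (s ^+ 2 / (32 * n%:R))) = delta.
  have -> : s ^+ 2 / (32 * n%:R) = ln (1 / delta).
    by rewrite /s !exprMn b2; field; rewrite gt_eqF.
  by rewrite expRN lnK ?div1r ?invrK// posrE invr_gt0.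
rewrite sd in PA.
exists A; split => //; split => // w Aw f Df.
rewrite /emp_mean -(ler_pM2l nR) -{1}(gtr0_norm nR) -normrM mulrBr.
rewrite mulrA divff ?gt_eqF// mul1r.
apply: le_trans (Adev w Aw f Df) _.
have L0 : 0 <= 2 ^+ L :> R by rewrite exprn_ge0.
have h1 : 2 ^+ L * Num.sqrt (p.+1%:R * n%:R) <= 2 ^+ L * (2 * n%:R * a).
  by rewrite ler_wpM2l.
have h2 : 0 <= n%:R * b by rewrite mulr_ge0// ltW.
have -> : n%:R * (160 * (2 ^+ L * a + b)) = 80 * (2 ^+ L * (2 * n%:R * a)) + 160 * (n%:R * b).
  by ring.
rewrite [2 ^+ L * (40 * _)]mulrCA /s; move: h1 h2.
set u := 2 ^+ L * _; set v := 2 ^+ L * _; set z := n%:R * b; clear.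
have -> : 4 * n%:R * b = 4 * z by rewrite mulrA.
have -> : 2 * n%:R * (2 * b) = 4 * z by rewrite /z; ring.
lra.
Qed.

End Deviation.

(** * Optimality of the estimator *)

Lemma expectE (R : realType) p (Q : probability (Rp R p) R) (B : R) L f :
  Dnet B L f -> expect Q f = (mean Q f)%:E.
Proof. by move=> Df; rewrite -meanE//; exact: Dnet_bounded_measurable Df. Qed.

Lemma W1_ge0 (R : realType) p (P Q : probability (Rp R p) R) : (0 <= W1 P Q)%E.
Proof.
apply: le_ereal_inf_tmp => _ [Pi _ <-]; apply: integral_ge0 => z _.
by rewrite lee_fin norm2_ge0.
Qed.

(** Optimality compares [th_hat] with [th_star] and bounds the objective by [r]; the triangle
    inequality through the empirical mean then costs [r] twice. *)
Lemma wgan_bound (R : realType) (p n : nat) (Theta : Type)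
    (Pth : Theta -> probability (Rp R p) R) (th_star th_hat : Theta)
    (P : probability (Rp R p) R) (xs : 'I_n -> 'rV[R]_p) (B eps t : R) L :
  0 < B -> (W1 P (Pth th_star) <= eps%:E)%E ->
  is_wgan_estimate Pth (@Dnet R p B L) xs th_hat ->
  (forall f, Dnet B L f -> `|emp_mean xs f - mean P f| <= t) ->
  (ereal_sup [set `| (expect (Pth th_star) f - expect (Pth th_hat) f)%E |%E
             | f in @Dnet R p B L] <= (2 * t + B / 2 * eps)%:E)%E.
Proof.
move=> B0 W est dev.
have B4 : 0 <= B / 4 by rewrite divr_ge0// ltW.
pose r := t + B / 4 * eps.
have star f : Dnet B L f -> `|emp_mean xs f - mean (Pth th_star) f| <= r.
  move=> Df; have bf := Dnet_bounded_measurable Df.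
  have := W1_mean B4 W bf (fun x y => Dnet_lip x y (ltW B0) Df).
  have := dev f Df; have := ler_distD (mean P f) (emp_mean xs f) (mean (Pth th_star) f).
  by rewrite /r; lra.
have hat1 f : Dnet B L f -> emp_mean xs f - mean (Pth th_hat) f <= r.
  move=> Df; rewrite -lee_fin EFinB -(expectE _ Df).
  apply: (@le_trans _ _ (wgan_obj Pth (@Dnet R p B L) xs th_hat)).
    by apply: ereal_sup_ubound; exists f.
  apply: le_trans (est th_star) _; apply: ge_ereal_sup => _ [g Dg <-].
  by rewrite (expectE _ Dg) -EFinB lee_fin (le_trans (ler_norm _))// star.
have hat f : Dnet B L f -> `|emp_mean xs f - mean (Pth th_hat) f| <= r.
  move=> Df; rewrite ler_norml hat1// andbT.
  (* The class contains [- f], which gives the other side of the absolute value. *)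
  have := hat1 _ (Dnet_opp Df).
  have -> : emp_mean xs (fun x => - f x) = - emp_mean xs f.
    by rewrite /emp_mean sumrN mulrN.
  have -> : mean (Pth th_hat) (fun x => - f x) = - mean (Pth th_hat) f.
    rewrite -mulN1r -meanZ; last exact: Dnet_bounded_measurable Df.
    by congr mean; apply/funext => x; rewrite mulN1r.
  lra.
apply: ge_ereal_sup => _ [f Df <-].
rewrite !(expectE _ Df) -EFinB lee_fin.
have := star f Df; have := hat f Df; rewrite distrC.
have := ler_distD (emp_mean xs f) (mean (Pth th_star) f) (mean (Pth th_hat) f).
rewrite [`|_ - emp_mean xs f|]distrC [`|mean (Pth th_hat) f - _|]distrC /r.
lra.
Qed.

(* On [R^0] every function is constant, so the left-hand side vanishes. *)
Lemma wgan_bound_dim0 (R : realType) (Q Q' : probability (Rp R 0) R) (B t : R) L :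
  0 <= t ->
  (ereal_sup [set `| (expect Q f - expect Q' f)%E |%E | f in @Dnet R 0 B L] <= t%:E)%E.
Proof.
move=> t0; apply: ge_ereal_sup => _ [f Df <-].
have fE : f = fun=> f 0 by apply/funext => x; congr f; apply/rowP => -[].
by rewrite !(expectE _ Df) fE !mean_cst -EFinB subrr /= normr0 lee_fin.
Qed.

From Stdlib Require Rdefinitions.
From mathcomp Require Import Rstruct Rstruct_topology.
Notation R := Rdefinitions.R (only parsing).

Theorem theorem1 :
  exists C : R, 0 < C /\
  forall (p : nat) (Theta : Type) (Pth : Theta -> probability (Rp R p) R)
    (th_star : Theta) (P : probability (Rp R p) R) (eps : R)
    (n : nat) (d : measure_display) (Omega : measurableType d)
    (Pr : probability Omega R) (X : 'I_n -> Omega -> Rp R p)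
    (B : R) (L : nat) (th_hat : Omega -> Theta) (delta : R),
    (forall th, finite_first_moment (Pth th)) ->
    (W1 P (Pth th_star) <= eps%:E)%E ->
    (0 < n)%N ->
    iid_sample Pr X P ->
    0 < B -> (2 <= L)%N ->
    (forall w : Omega,
        is_wgan_estimate Pth (@Dnet R p B L) (fun i => X i w) (th_hat w)) ->
    0 < delta ->
    exists A : set Omega, measurable A /\ ((1 - delta)%:E <= Pr A)%E /\
      forall w, A w ->
        (ereal_sup [set `| (expect (Pth th_star) f - expect (Pth (th_hat w)) f)%E |%E
                   | f in @Dnet R p B L]
         <= (2 * C * (2 ^+ L * Num.sqrt (p%:R / n%:R)
                      + Num.sqrt (2 * ln (1 / delta) / n%:R))
             + B / 2 * eps)%:E)%E.
Proof.
exists 160; split; first by rewrite ltr0n.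
move=> p Theta Pth th_star P eps n d Omega Pr X B L th_hat delta _ W n0 iidX B0 L2 est d0.
have eps0 : 0 <= eps by rewrite -lee_fin (le_trans _ W)// W1_ge0.
have [d1|d1] := leP 1 delta.
  (* For [delta >= 1] the required probability is nonpositive. *)
  by exists set0; split => //; split => //; rewrite measure0 lee_fin subr_le0.
(* Dimension 0 is separate because [p + 1] cannot be absorbed into a multiple of [p] there. *)
case: p Pth P X iidX W est => [|p] Pth P X iidX W est.
  exists setT; split => //; split=> [|w _].
    by rewrite (probability_setT Pr) lee_fin lerBlDr lerDl ltW.
  have Beps : 0 <= B / 2 * eps by rewrite mulr_ge0// divr_ge0// ltW.
  by apply: wgan_bound_dim0; apply: addr_ge0 => //; apply: mulr_ge0.
have dd : 0 < delta < 1 by rewrite d0.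
have [A [mA [PA Adev]]] := Dnet_deviation_le iidX (ltn0Sn p) n0 B0 L2 dd.
exists A; split => //; split => // w Aw; rewrite -mulrA.
by apply: (wgan_bound B0 W (est w)) => f; exact: Adev.
Qed.
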